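(* Let $k$ be an algebraically closed field, let $F\in R=k[x,y,z]$ be homogeneous of degree $d+1$ defining a reduced curve in $\mathbb{P}^2$, with $\mathrm{char}(k)\nmid d+1$. Let $\epsilon$ be a minimal-degree homogeneous generator of $\mathrm{Syz}(J_F)$, let $I_\epsilon$ be the associated Bourbaki ideal, and let $\ell=|V(I_\epsilon)|$. Then $\mathrm{Bour}(F)\geq \ell$, with equality if and only if $\mathrm{Bour}_P(F)=1$ for every $P\in V(I_\epsilon)$. In particular, $F$ is nearly free if and only if $V(I_\epsilon)=\{P_0\}$ for a single point $P_0$ and $\mathrm{Bour}_{P_0}(F)=1$.
   Context: $R=k[x,y,z]$ has the standard grading. $J_F=\langle F_x,F_y,F_z\rangle$ is the Jacobian ideal of $F$, and $\mathrm{Syz}(J_F)=\{(a,b,c)\in R^3 : aF_x+bF_y+cF_z=0\}$, a finitely generated graded $R$-module in which the degree of a homogeneous element is the common degree of its entries. Let $\epsilon$ be a nonzero homogeneous element of $\mathrm{Syz}(J_F)$ of minimal degree $e$ (a minimal-degree member of a homogeneous generating set), and $M_\epsilon=\mathrm{Syz}(J_F)/R\epsilon$. The Bourbaki ideal $I_\epsilon\subseteq R$ is the homogeneous ideal whose generators have no common factor of positive degree and for which there is a graded isomorphism $M_\epsilon\simeq I_\epsilon(e-d)$; thus there is an exact sequence $0\to R(-e)\to \mathrm{Syz}(J_F)\to I_\epsilon(e-d)\to 0$. Either $I_\epsilon=R$ or $I_\epsilon$ has codimension $2$, so its zero set $V(I_\epsilon)\subseteq\mathbb{P}^2$ is finite.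 The Bourbaki degree is $\mathrm{Bour}(F)=\deg(R/I_\epsilon)$, where $\deg(R/I_\epsilon)$ is the constant value of $\dim_k(R/I_\epsilon)_n$ for $n\gg0$ (it is $0$ if $I_\epsilon=R$). The local Bourbaki degree at $P=(a:b:1)$ is $\mathrm{Bour}_P(F)=\dim_k\left(k[x,y]/I_\epsilon(x,y,1)\right)_{\langle x-a,y-b\rangle}$, where $I_\epsilon(x,y,1)=\{f(x,y,1): f\in I_\epsilon\}$ is the dehomogenization with respect to $z$. At points with $z=0$ it is defined in the same way after dehomogenizing with respect to another coordinate that does not vanish at $P$ (equivalently, after a projective change of coordinates). The curve $F$ is nearly free if $\mathrm{Syz}(J_F)$ is minimally generated by three homogeneous elements of degrees $d_1\le d_2=d_3$ with $d_1+d_2=\deg F=d+1$. *)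

(* Defs.v *)
From HB Require Import structures.
From mathcomp Require Import all_boot all_order all_algebra fraction.
From mathcomp Require Import mpoly.
From mathcomp Require Import boolp classical_sets functions cardinality.

Set Implicit Arguments.
Unset Strict Implicit.
Unset Printing Implicit Defensive.

Import GRing.Theory.
Local Open Scope classical_set_scope.
Local Open Scope ring_scope.

Definition ideal_gen (A : comNzRingType) (gs : seq A) : set A :=
  [set f | exists c : 'I_(size gs) -> A, f = \sum_i c i * gs`_i].

(* The classes of the b i form a k-basis of V / (V `&` W), for k-subspaces V
   and W of E.  The scalar action is a parameter because {fraction _} carries
   no canonical lmodType structure over k. *)
Definition quotient_basis (k : nzRingType) (E : zmodType) (scale : k -> E -> E)
    (V W : set E) (n : nat) (b : 'I_n -> E) : Prop :=
  [/\ forall i, V (b i),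
      forall c : 'I_n -> k, W (\sum_i scale (c i) (b i)) -> forall i, c i = 0 &
      forall v, V v -> exists c : 'I_n -> k, W (v - \sum_i scale (c i) (b i))].

(* Defaults to 0 if the quotient is infinite-dimensional. *)
Definition quotient_dim (k : nzRingType) (E : zmodType) (scale : k -> E -> E)
    (V W : set E) : nat :=
  xget 0%N [set n | exists b : 'I_n -> E, quotient_basis scale V W b].

Definition reduced_form (k : fieldType) (F : {mpoly k[3]}) : Prop :=
  F != 0 /\
  forall G H : {mpoly k[3]}, F = G ^+ 2 * H -> (msize G <= 1)%N.

Definition Syz (k : fieldType) (F : {mpoly k[3]}) : set 'rV[{mpoly k[3]}]_3 :=
  [set v | \sum_(i < 3) v 0 i * F^`M(i) = 0].

Definition vec_homog (k : fieldType) (n : nat) (v : 'rV[{mpoly k[3]}]_3) :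
    Prop :=
  forall i, v 0 i \is n.-homog.

Definition minimal_syzygy (k : fieldType) (F : {mpoly k[3]}) (e : nat)
    (eps : 'rV[{mpoly k[3]}]_3) : Prop :=
  [/\ Syz F eps, eps != 0, vec_homog e eps &
      forall n v, Syz F v -> v != 0 -> vec_homog n v -> (e <= n)%N].

(* Membership in the degree-m part of k[x,y,z] for an integer m; this part is
   zero when m < 0. *)
Definition zhomog (k : fieldType) (m : int) (f : {mpoly k[3]}) : Prop :=
  forall mon, mon \in msupp f -> (mdeg mon)%:Z = m.

(* phi induces an isomorphism of graded modules Syz F / R eps -> I(t): on
   Syz F it is R-linear, with image I and kernel R eps, and it maps degree n
   to I(t)_n = I_(n + t).  Values of phi outside Syz F are irrelevant. *)
Definition graded_iso (k : fieldType) (F : {mpoly k[3]})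
    (eps : 'rV[{mpoly k[3]}]_3) (I : set {mpoly k[3]}) (t : int)
    (phi : 'rV[{mpoly k[3]}]_3 -> {mpoly k[3]}) : Prop :=
  [/\ forall (a : {mpoly k[3]}) u v, Syz F u -> Syz F v ->
        phi (a *: u + v) = a * phi u + phi v,
      phi @` Syz F = I,
      forall v, Syz F v -> (phi v = 0 <-> exists a : {mpoly k[3]}, v = a *: eps)
    & forall (n : nat) v, Syz F v -> vec_homog n v ->
        zhomog (n%:Z + t) (phi v)].

(* F has degree d + 1 and eps has degree e. *)
Definition bourbaki_ideal (k : fieldType) (d : nat) (F : {mpoly k[3]})
    (e : nat) (eps : 'rV[{mpoly k[3]}]_3) (I : set {mpoly k[3]}) : Prop :=
  (exists gs : seq {mpoly k[3]},
    [/\ I = ideal_gen gs,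
        forall g, g \in gs -> exists n : nat, g \is n.-homog &
        forall h : {mpoly k[3]},
          (forall g, g \in gs -> exists q, g = q * h) -> (msize h <= 1)%N]) /\
  exists phi, graded_iso F eps I (e%:Z - d%:Z) phi.

(* dim_k (k[x,y,z] / I)_n *)
Definition hilbert_fun (k : fieldType) (I : set {mpoly k[3]}) (n : nat) : nat :=
  quotient_dim (fun (c : k) (f : {mpoly k[3]}) => c *: f)
    [set f | f \is n.-homog] I.

(* The value of hilbert_fun I for all large n; defaults to 0 if hilbert_fun I
   is not eventually constant. *)
Definition bour (k : fieldType) (I : set {mpoly k[3]}) : nat :=
  xget 0%N [set c | exists N, forall n, (N <= n)%N -> hilbert_fun I n = c].

(* Each point of the projective plane is represented by its unique vector of
   homogeneous coordinates whose last nonzero entry is 1: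
   (a : b : 1), (a : 1 : 0) or (1 : 0 : 0). *)
Definition last_nonzero_is1 (k : fieldType) (v : 'rV[k]_3) (i : 'I_3) : bool :=
  (v 0 i == 1) && [forall j : 'I_3, (i < j)%N ==> (v 0 j == 0)].

Definition normalized (k : fieldType) (v : 'rV[k]_3) : bool :=
  [exists i, last_nonzero_is1 v i].

Definition P2 (k : fieldType) := {v : 'rV[k]_3 | normalized v}.

Definition coords (k : fieldType) (P : P2 k) (i : 'I_3) : k := (val P) 0 i.

(* The coordinate equal to 1 used to dehomogenize at P: it is z whenever z does
   not vanish at P.  The default value is never used. *)
Definition chart (k : fieldType) (P : P2 k) : 'I_3 :=
  odflt ord_max [pick i | last_nonzero_is1 (val P) i].

Definition zero_locus (k : fieldType) (I : set {mpoly k[3]}) : set (P2 k) :=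
  [set P | forall f, I f -> f.@[coords P] = 0].

(* Sets the i-th variable to 1 and renames the other two, in order, to the
   variables of {mpoly k[2]}; for i = 2 this is f(x, y, 1). *)
Definition dehom (k : fieldType) (i : 'I_3) (f : {mpoly k[3]}) : {mpoly k[2]} :=
  f \mPo [tuple (if unlift i j is Some j' then 'X_j' else 1) | j < 3].

Definition point_ideal (k : fieldType) (a : 'I_2 -> k) : set {mpoly k[2]} :=
  ideal_gen [seq 'X_j - (a j)%:MP | j <- enum 'I_2].

(* The fractions f / s with f in J and s outside the prime ideal m, i.e. the
   extension of the ideal J to the local ring A_m, as a subset of Frac A. *)
Definition localize (A : idomainType) (m J : set A) : set {fraction A} :=
  [set x | exists f s, [/\ J f, ~ m s & x = tofrac f / tofrac s]].

(* The localization (A / J)_m is A_m / J A_m, for A = k[x,y] and J the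
   dehomogenization of I. *)
Definition local_bour (k : fieldType) (I : set {mpoly k[3]}) (P : P2 k) : nat :=
  let i := chart P in
  let m := point_ideal (fun j => coords P (lift i j)) in
  quotient_dim
    (fun (c : k) (x : {fraction {mpoly k[2]}}) => tofrac c%:MP_[2] * x)
    (localize m setT) (localize m (dehom i @` I)).

Definition spans (k : fieldType) (n : nat) (g : 'I_n -> 'rV[{mpoly k[3]}]_3)
    (J : {set 'I_n}) : set 'rV[{mpoly k[3]}]_3 :=
  [set v | exists c : 'I_n -> {mpoly k[3]}, v = \sum_(i in J) c i *: g i].

Definition minimally_generates (k : fieldType) (n : nat)
    (g : 'I_n -> 'rV[{mpoly k[3]}]_3) (M : set 'rV[{mpoly k[3]}]_3) : Prop :=
  spans g [set: 'I_n]%SET = M /\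
  forall J : {set 'I_n}, J \proper [set: 'I_n]%SET -> spans g J <> M.

(* F has degree d + 1. *)
Definition nearly_free (k : fieldType) (d : nat) (F : {mpoly k[3]}) : Prop :=
  exists (d1 d2 d3 : nat) (g : 'I_3 -> 'rV[{mpoly k[3]}]_3),
    [/\ forall i : 'I_3, vec_homog (nth 0%N [:: d1; d2; d3] i) (g i),
        minimally_generates g (Syz F),
        (d1 <= d2)%N, d2 = d3 & (d1 + d2)%N = d.+1].

(* Main.v *)
(* Write J for the forms vanishing on V(I).  Interpolation at the points of
   V(I) shows that the Hilbert function of R/I is eventually at least |V(I)|,
   with equality exactly when I and J agree in large degrees; so the formula
   expressing Bour(F) as a sum of local degrees is not needed, only the fact
   that I and J agree in large degrees iff I generates the maximal ideal
   locally at each point of V(I).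

   Since the generators of I have no common factor, I contains a product of
   linear forms in x and y (pseudo-division in z), and hence I + (l) contains
   all forms of large degree for a suitable line l.  So multiplication by l on
   R/I is eventually surjective, then bijective by finite dimension, and the
   Hilbert function stabilizes.  If a form v in J of large degree is not in I,
   the commuting operators x/l, y/l, z/l on R/I have a common eigenvector w
   among the multiples of v; its eigenvalues are the coordinates of a point P
   of V(I), and a form f acts on w as f(P) times a power of l.  A form s with
   s(P) <> 0 and s w in I then forces w in I, a contradiction.

   Finally I is saturated because Syz(J_F) is reflexive.  Hence
   V(I) = {P0} with Bour_P0(F) = 1 means that I is generated by two independent
   linear forms, which lift to two syzygies completing epsilon to a generating
   set with the degrees of a nearly free curve. *)
Require Import Defs.
From HB Require Import structures.
From mathcomp Require Import all_boot all_order all_algebra fraction.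
From mathcomp Require Import mpoly ring.
From mathcomp Require Import boolp classical_sets functions cardinality.

Set Implicit Arguments.
Unset Strict Implicit.
Unset Printing Implicit Defensive.

Import GRing.Theory.
Local Open Scope classical_set_scope.
Local Open Scope ring_scope.

(** * Ideals, homogeneous components and substitutions *)

Definition ideal (A : comNzRingType) (K : set A) : Prop :=
  [/\ K 0, forall a b, K a -> K b -> K (a + b) & forall c a, K a -> K (c * a)].

Section Ideals.
Variables (A : comNzRingType) (K : set A).
Hypothesis idK : ideal K.

Lemma ideal0 : K 0. Proof. by case: idK. Qed.
Lemma idealD a b : K a -> K b -> K (a + b). Proof. by case: idK => _ + _; apply. Qed.
Lemma idealM c a : K a -> K (c * a). Proof. by case: idK => _ _; apply. Qed.
Lemma ideal_mulr c a : K a -> K (a * c). Proof. by rewrite mulrC; apply: idealM. Qed.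
Lemma idealN a : K a -> K (- a). Proof. by rewrite -mulN1r; apply: idealM. Qed.
Lemma idealB a b : K a -> K b -> K (a - b).
Proof. by move=> Ka /idealN; apply: idealD. Qed.
Lemma ideal_sum (T : Type) (r : seq T) (P : pred T) (F : T -> A) :
  (forall i, P i -> K (F i)) -> K (\sum_(i <- r | P i) F i).
Proof. by move=> KF; elim/big_ind: _ => //; [apply: ideal0 | apply: idealD]. Qed.
Lemma ideal_congr a b : K (a - b) -> K a <-> K b.
Proof.
move=> Kab; split=> [Ka|Kb]; last by rewrite -(subrK b a); apply: idealD.
by rewrite -(subKr a b); apply: idealB.
Qed.
Lemma ideal_congrM a b c d : K (a - b) -> K (c - d) -> K (a * c - b * d).
Proof.
move=> Kab Kcd; have -> : a * c - b * d = c * (a - b) + b * (c - d).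
  by rewrite mulrBr [c * a]mulrC mulrBr [c * b]mulrC subrKA.
by apply: idealD; apply: idealM.
Qed.
Lemma ideal_congrX a b n : K (a - b) -> K (a ^+ n - b ^+ n).
Proof.
move=> Kab; elim: n => [|n IH]; first by rewrite subrr; apply: ideal0.
by rewrite !exprS; apply: ideal_congrM.
Qed.
End Ideals.

Lemma ideal_gen_ideal (A : comNzRingType) (gs : seq A) : ideal (ideal_gen gs).
Proof.
split=> [|a b [c ->] [d ->]|c a [d ->]].
- by exists (fun=> 0); rewrite big1 // => i _; rewrite mul0r.
- by exists (fun i => c i + d i); rewrite -big_split; apply: eq_bigr => i _; rewrite mulrDl.
- by exists (fun i => c * d i); rewrite mulr_sumr; apply: eq_bigr => i _; rewrite mulrA.
Qed.

Lemma mem_ideal_gen (A : comNzRingType) (gs : seq A) g : g \in gs -> ideal_gen gs g.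
Proof.
move=> gin; have lt := gin; rewrite -index_mem in lt.
exists (fun i => (i == Ordinal lt)%:R).
rewrite (bigD1 (Ordinal lt)) //= eqxx mul1r nth_index // big1 ?addr0 // => i /negbTE ->.
by rewrite mul0r.
Qed.

Lemma ideal_gen_min (A : comNzRingType) (gs : seq A) (K : set A) : ideal K ->
  (forall g, g \in gs -> K g) -> ideal_gen gs `<=` K.
Proof.
move=> idK Kgs _ [c ->]; apply: (ideal_sum idK) => i _.
by apply: (idealM idK); apply: Kgs; apply: mem_nth.
Qed.

Lemma ideal_preimage (A B : comNzRingType) (f : {rmorphism A -> B}) (K : set B) :
  ideal K -> ideal [set a | K (f a)].
Proof.
move=> idK; split=> [|a b|c a] /=.
- by rewrite rmorph0; apply: ideal0.
- by rewrite rmorphD; apply: idealD.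
- by rewrite rmorphM; apply: idealM.
Qed.

Lemma ideal_colon (A : comNzRingType) (K : set A) w :
  ideal K -> ideal [set a | K (a * w)].
Proof.
move=> idK; split=> [|a b|c a] /=.
- by rewrite mul0r; apply: ideal0.
- by rewrite mulrDl; apply: idealD.
- by rewrite -mulrA; apply: idealM.
Qed.

Section Mpoly.
Variable k : fieldType.

(** Polynomials are built from constants and variables by sums and products, which respect
    congruence modulo [K]. Substitution modulo an ideal reduces to this, and the zero ideal gives
    equality of morphisms. *)
Lemma mpoly_rmorph_congr n (B : comNzRingType) (K : set B) (idK : ideal K)
    (f g : {rmorphism {mpoly k[n]} -> B}) :
  (forall c, K (f c%:MP - g c%:MP)) -> (forall i, K (f 'X_i - g 'X_i)) ->
  forall p, K (f p - g p).
Proof.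
move=> fgC fgX p; rewrite [p]mpolyE !rmorph_sum -sumrB; apply: (ideal_sum idK) => m _.
rewrite -mul_mpolyC !rmorphM; apply: (ideal_congrM idK); first exact: fgC.
rewrite mpolyXE_id !rmorph_prod.
apply: (big_rec2 (fun a b => K (a - b))) => [|i a b _ Kab].
  by rewrite subrr; apply: ideal0.
by apply: (ideal_congrM idK) => //; rewrite !rmorphXn; apply: (ideal_congrX idK).
Qed.

Lemma mpoly_rmorph_ext n (B : comNzRingType) (f g : {rmorphism {mpoly k[n]} -> B}) :
  (forall c, f c%:MP = g c%:MP) -> (forall i, f 'X_i = g 'X_i) -> f =1 g.
Proof.
move=> fgC fgX p; apply: subr0_eq.
apply: (@mpoly_rmorph_congr _ _ [set 0]) => [|c|i].
- split=> [//|a b -> ->|c a ->]; rewrite /= ?addr0 ?mulr0 //.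
- by rewrite /= fgC subrr.
- by rewrite /= fgX subrr.
Qed.

Lemma comp_mpoly_congr n m (K : set {mpoly k[m]}) (idK : ideal K)
    (u v : n.-tuple {mpoly k[m]}) f :
  (forall i, K (tnth u i - tnth v i)) -> K ((f \mPo u) - (f \mPo v)).
Proof.
move=> Kuv; apply: (mpoly_rmorph_congr idK) => [c|i].
  by rewrite /= !comp_mpolyC subrr; apply: ideal0.
by rewrite /= !comp_mpolyXU -!tnth_nth.
Qed.

Lemma comp_mpoly_comp n m l (u : n.-tuple {mpoly k[m]}) (v : m.-tuple {mpoly k[l]}) f :
  (f \mPo u) \mPo v = f \mPo [tuple tnth u i \mPo v | i < n].
Proof.
apply: (mpoly_rmorph_ext (f := (comp_mpoly v) \o (comp_mpoly u))) => [c|i] /=.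
  by rewrite !comp_mpolyC.
by rewrite !comp_mpolyXU -!tnth_nth tnth_mktuple.
Qed.

Lemma homogM_eq n (p q : {mpoly k[n]}) d e m :
  p \is d.-homog -> q \is e.-homog -> (d + e = m)%N -> p * q \is m.-homog.
Proof. by move=> hp hq <-; apply: dhomogM. Qed.

Lemma homogXU n (i : 'I_n) : 'X_i \is [in k[n], 1.-homog].
Proof. by rewrite dhomogX /= mdeg1. Qed.

Lemma homog_cond_prod n (T : Type) (r : seq T) (P : pred T) (F : T -> {mpoly k[n]})
    (d : T -> nat) : (forall i, P i -> F i \is (d i).-homog) ->
  \prod_(i <- r | P i) F i \is (\sum_(i <- r | P i) d i).-homog.
Proof.
move=> hF; apply: (big_rec2 (fun (p : {mpoly k[n]}) e => p \is e.-homog)).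
  exact: dhomog1.
by move=> i p e Pi; apply: dhomogM; apply: hF.
Qed.

Lemma mmap1_homog n m (h : 'I_n -> {mpoly k[m]}) mon e :
  (forall i, h i \is e.-homog) -> mmap1 h mon \is (e * mdeg mon).-homog.
Proof.
move=> hh; rewrite /mmap1 mdegE big_distrr /=.
by apply: (@homog_cond_prod _ _ _ _ _ (fun i => (e * mon i)%N)) => i _; apply: dhomogMn.
Qed.

Lemma comp_homog n m (u : n.-tuple {mpoly k[m]}) f d :
  (forall i, tnth u i \is 1.-homog) -> f \is d.-homog -> f \mPo u \is d.-homog.
Proof.
move=> hu hf; rewrite /comp_mpoly /mmap big_seq.
apply: rpred_sum => mon hm; rewrite mul_mpolyC; apply: rpredZ.
have <- : (1 * mdeg mon)%N = d by rewrite mul1n -(dhomog_mf hf hm).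
exact: mmap1_homog.
Qed.

Lemma comp_homog_scale n m (u : 'I_n -> {mpoly k[m]}) t f d :
  f \is d.-homog ->
  f \mPo [tuple t * u i | i < n] = t ^+ d * (f \mPo [tuple u i | i < n]).
Proof.
move=> hf; rewrite /comp_mpoly /mmap mulr_sumr; apply: eq_big_seq => mon hm.
have <- : mdeg mon = d by rewrite -(dhomog_mf hf hm).
rewrite mulrCA; congr (_ * _); rewrite /mmap1 mdegE -prodrXr -big_split.
by apply: eq_bigr => i _; rewrite !tnth_mktuple exprMn.
Qed.

Lemma comp_const n m (p : 'I_n -> k) (f : {mpoly k[n]}) :
  f \mPo [tuple (p i)%:MP_[m] | i < n] = (f.@[p])%:MP.
Proof.
apply: (mpoly_rmorph_ext (f := comp_mpoly _) (g := (mpolyC m (R := k)) \o meval p)) => [c|i] /=.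
  by rewrite comp_mpolyC mevalC.
by rewrite comp_mpolyXU -tnth_nth tnth_mktuple mevalXU.
Qed.

Lemma comp_homog_point n m (p : 'I_n -> k) t (f : {mpoly k[n]}) d :
  f \is d.-homog ->
  f \mPo [tuple t * (p i)%:MP_[m] | i < n] = t ^+ d * (f.@[p])%:MP.
Proof. by move=> hf; rewrite (comp_homog_scale _ _ hf) comp_const. Qed.

(** Once [p] is split into components, only the one of degree [d - e] contributes. The case [d < e]
    is separate because subtraction is truncated. *)
Lemma pihomogM n (p q : {mpoly k[n]}) d e : q \is e.-homog ->
  pihomog mdeg d (p * q) = if (e <= d)%N then pihomog mdeg (d - e) p * q else 0.
Proof.
move=> hq; pose b := maxn (msize p) d.+1.
rewrite {1}(pihomog_partitionE (leq_maxl (msize p) d.+1)) mulr_suml linear_sum /=.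
have E (i : 'I_b) : pihomog mdeg d (pihomog mdeg i p * q) =
    if (i + e == d)%N then pihomog mdeg i p * q else 0.
  case: eqVneq => [<-|ne]; first by rewrite pihomog_dE //; apply: dhomogM hq; apply: pihomogP.
  by apply: pihomog_ne0 ne _; apply: dhomogM hq; apply: pihomogP.
rewrite (eq_bigr _ (fun i _ => E i)); case: leqP => [le|lt].
  have ltb : (d - e < b)%N by rewrite (leq_trans _ (leq_maxr _ _)) // ltnS leq_subr.
  rewrite (bigD1 (Ordinal ltb)) //= subnK // eqxx big1 ?addr0 // => i ne.
  case: eqP => // de; case/eqP: ne; apply: val_inj => /=.
  by rewrite -de addnK.
rewrite big1 // => i _; case: eqP => // de.
by move: lt; rewrite -de ltnNge leq_addl.
Qed.

Definition graded n (I : set {mpoly k[n]}) : Prop :=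
  forall f d, I f -> I (pihomog mdeg d f).

Lemma ideal_gen_graded n (gs : seq {mpoly k[n]}) :
  (forall g, g \in gs -> exists d, g \is d.-homog) -> graded (ideal_gen gs).
Proof.
move=> hgs f d [c ->]; rewrite linear_sum; apply: (ideal_sum (ideal_gen_ideal gs)) => i _ /=.
have gin : gs`_i \in gs by apply: mem_nth.
have [e he] := hgs _ gin; rewrite (pihomogM _ _ he); case: ifP => _.
  by apply: (idealM (ideal_gen_ideal gs)); apply: mem_ideal_gen.
exact: (ideal0 (ideal_gen_ideal gs)).
Qed.

Lemma linear_form_sum n (l : {mpoly k[n]}) : l \is 1.-homog ->
  l = \sum_j l@_U_(j) *: 'X_j.
Proof.
move=> hl; apply/mpolyP => m; rewrite linear_sum /=.
have [/mdeg1P[j /eqP ->]|m1] := boolP (mdeg m == 1%N).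
  rewrite (bigD1 j) //= mcoeffZ mcoeffXU eqxx mulr1 big1 ?addr0 // => j' ne.
  by rewrite mcoeffZ mcoeffXU (negbTE ne) mulr0.
rewrite (dhomog_nemf_coeff hl m1) big1 // => j _; rewrite mcoeffZ mcoeffX.
by case: eqP => [E|]; rewrite ?mulr0 //; rewrite -E mdeg1 in m1.
Qed.

(* Substituting X_i - l / a for X_i, where a is the coefficient of X_i in l,
   identifies the quotient by l with a subring of the polynomial ring. *)
Lemma linear_retraction n (l : {mpoly k[n]}) : l != 0 -> l \is 1.-homog ->
  exists u : n.-tuple {mpoly k[n]},
    [/\ forall i, tnth u i \is 1.-homog, l \mPo u = 0 &
        forall f, exists q, f - (f \mPo u) = q * l].
Proof.
move=> l0 hl; have lead := mlead_supp l0.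
have /eqP/mdeg1P[i /eqP Ei] := dhomog_mf hl lead.
have ai : l@_U_(i) != 0 by rewrite -Ei -mcoeff_msupp.
pose u := [tuple 'X_j - ((j == i)%:R / l@_U_(i)) *: l | j < n].
have tu j : tnth u j = 'X_j - ((j == i)%:R / l@_U_(i)) *: l by rewrite tnth_mktuple.
exists u; split=> [j||f].
- by rewrite tu; apply: rpredB; [apply: homogXU | apply: rpredZ].
- rewrite {1}(linear_form_sum hl) linear_sum /=.
  under eq_bigr do rewrite comp_mpolyZ comp_mpolyXU -tnth_nth tu scalerBr.
  rewrite sumrB -(linear_form_sum hl) (bigD1 i) //= eqxx scalerA mulrCA divff // mulr1 scale1r.
  rewrite big1 ?addr0 ?subrr // => j /negbTE ->.
  by rewrite mul0r scale0r scaler0.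
- have idK : ideal [set h : {mpoly k[n]} | exists q, h = q * l].
    split=> [|a b [q ->] [r ->]|c a [q ->]] /=; first by exists 0; rewrite mul0r.
      by exists (q + r); rewrite mulrDl.
    by exists (c * q); rewrite mulrA.
  have := @comp_mpoly_congr n n _ idK [tuple 'X_j | j < n] u f.
  rewrite comp_mpoly_id; apply=> j; rewrite tu tnth_mktuple subKr /=.
  by exists ((j == i)%:R / l@_U_(i))%:MP; rewrite mul_mpolyC.
Qed.

(** The substitution of [linear_retraction] kills [l], lands in a domain and changes a polynomial
    only by multiples of [l]. Its kernel is thus the ideal of [l], which is prime. *)
Lemma linear_form_prime n (l p q : {mpoly k[n]}) : l != 0 -> l \is 1.-homog ->
  (exists r, p * q = r * l) -> (exists r, p = r * l) \/ (exists r, q = r * l).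
Proof.
move=> l0 hl; have [u [_ lu ret]] := linear_retraction l0 hl.
case=> r /(congr1 (comp_mpoly u)) /eqP; rewrite !rmorphM /= lu mulr0 mulf_eq0.
by case/orP=> /eqP E; [left; have := ret p | right; have := ret q]; rewrite E subr0.
Qed.

(** * Polynomials in the last variable *)

Definition zembed n (c : {mpoly k[n]}) : {mpoly k[n.+1]} :=
  c \mPo [tuple 'X_(widen_ord (leqnSn n) i) | i < n].

HB.instance Definition _ n := GRing.RMorphism.copy (@zembed n) (comp_mpoly _).

Lemma zembed_homog n (c : {mpoly k[n]}) d : c \is d.-homog -> zembed c \is d.-homog.
Proof. by apply: comp_homog => i; rewrite tnth_mktuple; apply: homogXU. Qed.

Lemma zembedZ n a (c : {mpoly k[n]}) : zembed (a *: c) = a *: zembed c.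
Proof. exact: comp_mpolyZ. Qed.

Lemma zembed_pihomog n (c : {mpoly k[n]}) d :
  pihomog mdeg d (zembed c) = zembed (pihomog mdeg d c).
Proof.
rewrite {1}(pihomog_partitionE (leq_maxl (msize c) d.+1)) rmorph_sum linear_sum /=.
rewrite (bigD1 (Ordinal (leq_maxr (msize c) d.+1))) //= big1 ?addr0 => [|i ne].
  by rewrite pihomog_dE //; apply: zembed_homog; apply: pihomogP.
apply: (@pihomog_ne0 _ _ _ i) => //; last by apply: zembed_homog; apply: pihomogP.
Qed.

(** The inverse of [muni]: the indeterminate becomes the last variable and the coefficients keep the
    other ones. *)
Definition of_muni n (p : {poly {mpoly k[n]}}) : {mpoly k[n.+1]} :=
  (map_poly (@zembed n) p).['X_ord_max].

HB.instance Definition _ n := GRing.RMorphism.copy (@of_muni n)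
  ((horner_eval 'X_ord_max) \o (map_poly (@zembed n))).

Lemma of_muniC n (c : {mpoly k[n]}) : of_muni c%:P = zembed c.
Proof. by rewrite /of_muni map_polyC hornerC. Qed.
Lemma of_muniX n : of_muni 'X = 'X_ord_max :> {mpoly k[n.+1]}.
Proof. by rewrite /of_muni map_polyX hornerX. Qed.

Lemma muniXU n (i : 'I_n) : muni 'X_(widen_ord (leqnSn n) i) = ('X_i)%:P :> {poly {mpoly k[n]}}.
Proof.
rewrite /muni mmapX mmap1U; case: splitP => [j|j] /= E; last first.
  by have := ltn_ord i; rewrite E ltnNge leq_addr.
by congr (_ %:P); congr 'X_ _; apply: val_inj.
Qed.

Lemma muniXmax n : muni 'X_ord_max = 'X :> {poly {mpoly k[n]}}.
Proof.
rewrite /muni mmapX mmap1U; case: splitP => [j|j] //= E.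
by have := ltn_ord j; rewrite -E ltnn.
Qed.

Lemma muniK n : cancel (@muni n k) (@of_muni n).
Proof.
apply: (mpoly_rmorph_ext (f := (@of_muni n) \o (@muni n k)) (g := idfun)) => [c|i] /=.
  by rewrite muniC of_muniC /zembed comp_mpolyC.
have [j ->|->] := unliftP ord_max i; last by rewrite muniXmax of_muniX.
have -> : lift ord_max j = widen_ord (leqnSn n) j by apply: val_inj; rewrite /= /bump leqNgt ltn_ord.
by rewrite muniXU of_muniC /zembed comp_mpolyXU -tnth_nth tnth_mktuple.
Qed.

Lemma muni_zembed n (c : {mpoly k[n]}) : muni (zembed c) = c%:P.
Proof.
apply: (mpoly_rmorph_ext (f := (@muni n k) \o (@zembed n)) (g := polyC)) => [a|i] /=.
  by rewrite /zembed comp_mpolyC muniC.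
by rewrite /zembed comp_mpolyXU -tnth_nth tnth_mktuple muniXU.
Qed.

Lemma of_muniK n : cancel (@of_muni n) (@muni n k).
Proof.
elim/poly_ind => [|p c IH]; first by rewrite !rmorph0.
by rewrite !rmorphD !rmorphM /= IH of_muniX of_muniC muniXmax muni_zembed.
Qed.

Lemma of_muni_poly n b (E : nat -> {mpoly k[n]}) :
  of_muni (\poly_(i < b) E i) = \sum_(i < b) zembed (E i) * 'X_ord_max ^+ i.
Proof.
rewrite poly_def rmorph_sum /=; apply: eq_bigr => i _.
by rewrite -mul_polyC rmorphM rmorphXn /= of_muniC of_muniX.
Qed.

(** A homogeneous component replaces the coefficient of each power of the last variable by one of
    its own components or by 0. *)
Lemma size_muni_pihomog n (f : {mpoly k[n.+1]}) d :
  (size (muni (pihomog mdeg d f)) <= size (muni f))%N.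
Proof.
pose p := muni f; have -> : f = of_muni p by rewrite muniK.
pose E i := if (i <= d)%N then pihomog mdeg (d - i) p`_i else 0.
suff -> : pihomog mdeg d (of_muni p) = of_muni (\poly_(i < size p) E i).
  by rewrite !of_muniK size_poly.
rewrite -{1}[p]coefK !of_muni_poly linear_sum; apply: eq_bigr => i _ /=.
have hX : 'X_ord_max ^+ i \is [in k[n.+1], (1 * i).-homog] by apply/dhomogMn/homogXU.
rewrite (pihomogM _ _ hX) mul1n /E; case: ifP => _; last by rewrite rmorph0 mul0r.
by rewrite zembed_pihomog.
Qed.

End Mpoly.

(** The polynomial [p * 'X + 1] is not constant, hence has a root [t], and [p] cannot vanish at
    [t]. *)
Lemma poly_nonroot (k : closedFieldType) (p : {poly k}) : p != 0 -> exists t, p.[t] != 0.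
Proof.
move=> p0; have : size (p * 'X + 1) != 1%N.
  by rewrite -[1]/(1%:P) size_MXaddC (negbTE p0) /= eqSS size_poly_eq0.
case/closed_rootP => t; rewrite /root !hornerE => /eqP E; exists t.
by apply: contra_eq_neq E => ->; rewrite mul0r add0r oner_neq0.
Qed.

(** Induction on the number of variables: a point where the leading coefficient in the last variable
    is nonzero leaves a nonzero univariate polynomial. *)
Lemma mpoly_nonzero_point (k : closedFieldType) n (f : {mpoly k[n]}) :
  f != 0 -> exists v, f.@[v] != 0.
Proof.
elim: n f => [|n IH] f f0.
  exists (fun=> 0); have E : f = (f@_0)%:MP by apply/mpolyP => m; rewrite mcoeffC nvar0_mnmE eqxx mulr1.
  by rewrite E mevalC; apply: contra_neq f0 => E0; rewrite E E0 mpolyC0.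
have lc0 : lead_coef (muni f) != 0.
  by rewrite lead_coef_eq0; apply: contra_neq f0 => E; rewrite -[f]muniK E rmorph0.
have [v hv] := IH _ lc0.
pose g := map_poly (meval v) (muni f).
have [t ht] : exists t, g.[t] != 0.
  apply: poly_nonroot; apply: contra_neq hv => E.
  by rewrite lead_coefE -coef_map -/g E coef0.
pose w (i : 'I_n.+1) := if unlift ord_max i is Some j then v j else t.
exists w; suff -> : f.@[w] = g.[t] by [].
apply: (mpoly_rmorph_ext (f := meval w)
  (g := (horner_eval t) \o (map_poly (meval v)) \o (@muni n k))) => [c|i] /=.
  by rewrite mevalC muniC map_polyC /= mevalC /horner_eval hornerC.
rewrite mevalXU /w; case: unliftP => [j|] ->.
  have -> : lift ord_max j = widen_ord (leqnSn n) j by apply: val_inj; rewrite /= /bump leqNgt ltn_ord.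
  by rewrite muniXU map_polyC /= mevalXU /horner_eval hornerC.
by rewrite muniXmax map_polyX /horner_eval hornerX.
Qed.

(** * Bases of a space modulo a subspace *)

Section QuotientBasis.
Variables (k : fieldType) (E : zmodType) (scale : k -> E -> E).
Hypothesis scaleDl : forall a b x, scale (a + b) x = scale a x + scale b x.
Hypothesis scaleDr : forall a x y, scale a (x + y) = scale a x + scale a y.
Hypothesis scaleA : forall a b x, scale a (scale b x) = scale (a * b) x.
Hypothesis scale1 : forall x, scale 1 x = x.
Variable W : set E.
Hypothesis W0 : W 0.
Hypothesis WD : forall x y, W x -> W y -> W (x + y).
Hypothesis WZ : forall a x, W x -> W (scale a x).

Definition lincomb n (c : 'I_n -> k) (b : 'I_n -> E) := \sum_i scale (c i) (b i).
Definition free_mod n (b : 'I_n -> E) :=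
  forall c, W (lincomb c b) -> forall i, c i = 0.
Definition span_mod n (b : 'I_n -> E) (v : E) := exists c, W (v - lincomb c b).

Let scale0x x : scale 0 x = 0.
Proof. by apply: (addrI (scale 0 x)); rewrite -scaleDl !addr0. Qed.
Let scalex0 a : scale a 0 = 0.
Proof. by apply: (addrI (scale a 0)); rewrite -scaleDr !addr0. Qed.
Let scaleN1 x : scale (-1) x = - x.
Proof. by apply: (addrI x); rewrite -{1}[x]scale1 -scaleDl !subrr scale0x. Qed.
Let scaleN a x : scale a (- x) = - scale a x.
Proof. by rewrite -!scaleN1 !scaleA mulrC. Qed.
Let scale_sumr a (T : finType) (F : T -> E) : scale a (\sum_i F i) = \sum_i scale a (F i).
Proof. exact: (big_morph _ (scaleDr a) (scalex0 a)). Qed.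
Let scale_suml x (T : finType) (F : T -> k) : scale (\sum_i F i) x = \sum_i scale (F i) x.
Proof. exact: (big_morph _ (fun a b => scaleDl a b x) (scale0x x)). Qed.
Let W_sum (T : finType) (F : T -> E) : (forall i, W (F i)) -> W (\sum_i F i).
Proof. by move=> WF; elim/big_ind: _. Qed.

(** Steinitz exchange: if [m < n], the matrix of coefficients has a nonzero vector in its left
    kernel, which gives a nontrivial relation modulo [W]. *)
Lemma free_mod_le_span n m (b : 'I_n -> E) (b' : 'I_m -> E) :
  free_mod b -> (forall i, span_mod b' (b i)) -> (n <= m)%N.
Proof.
move=> free_b span_b'; have [C hC] := choice span_b'.
rewrite leqNgt; apply/negP => lt_mn.
pose M : 'M[k]_(n, m) := \matrix_(i, j) C i j.
have /rowV0Pn[u /sub_kermxP uM u0] : kermx M != 0.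
  by rewrite kermx_eq0 /row_free neq_ltn (leq_ltn_trans (rank_leq_col M)).
case/eqP: u0; apply/rowP => i; rewrite [RHS]mxE; move: i; apply: (free_b (u 0)).
suff -> : lincomb (u 0) b = \sum_i scale (u 0 i) (b i - lincomb (C i) b').
  by apply: W_sum => i; apply: WZ.
under [RHS]eq_bigr do rewrite scaleDr scaleN.
rewrite sumrB [X in _ - X](_ : _ = 0) ?subr0 //.
under eq_bigr do rewrite scale_sumr.
rewrite exchange_big big1 //= => j _.
transitivity (scale ((u *m M) 0 j) (b' j)); last by rewrite uM mxE.
rewrite mxE scale_suml; apply: eq_bigr => i _.
by rewrite scaleA mxE.
Qed.

Lemma free_mod_extend n (b : 'I_n -> E) v : free_mod b -> ~ span_mod b v ->
  free_mod (fun i : 'I_n.+1 => oapp b v (unlift ord0 i)).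
Proof.
move=> free_b nspan c; rewrite /lincomb big_ord_recl unlift_none /=.
under eq_bigr do rewrite liftK.
move=> /= Wc; have c0 : c ord0 = 0.
  apply: contrapT => /eqP c0; apply: nspan; exists (fun i => - (c (lift ord0 i) / c ord0)).
  have := WZ (c ord0)^-1 Wc; rewrite scaleDr scaleA mulVf // scale1 scale_sumr /lincomb.
  rewrite -sumrN; congr (W (_ + _)); apply: eq_bigr => i _.
  by rewrite scaleA -[in RHS]scaleN1 scaleA mulN1r opprK mulrC.
move=> i; have [j ->|->] := unliftP ord0 i; last by [].
by apply: (free_b (fun j => c (lift ord0 j))); move: Wc; rewrite c0 scale0x add0r.
Qed.

Variable V : set E.

Lemma quotient_basis_uniq n m (b : 'I_n -> E) (b' : 'I_m -> E) :
  quotient_basis scale V W b -> quotient_basis scale V W b' -> n = m.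
Proof.
move=> [Vb fb sb] [Vb' fb' sb']; apply/eqP; rewrite eqn_leq; apply/andP; split.
  by apply: free_mod_le_span fb _ => i; apply: sb'.
by apply: free_mod_le_span fb' _ => i; apply: sb.
Qed.

Lemma quotient_dimE n (b : 'I_n -> E) :
  quotient_basis scale V W b -> quotient_dim scale V W = n.
Proof.
move=> hb; rewrite /quotient_dim; case: xgetP => [m _ [b' hb']|/(_ n) nex].
  exact: quotient_basis_uniq hb' hb.
by case: nex; exists b.
Qed.

(** A longest family of [V] free modulo [W] must span, and lengths are bounded by [m]. *)
Lemma quotient_basis_exists m (b' : 'I_m -> E) :
  (forall v, V v -> span_mod b' v) -> exists n (b : 'I_n -> E), quotient_basis scale V W b.
Proof.
move=> span_b'.
pose P n := `[< exists b : 'I_n -> E, (forall i, V (b i)) /\ free_mod b >].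
have P0 : exists n, P n by exists 0%N; apply/asboolP; exists (fun=> 0); split=> [[]|c _ []].
have Pm n : P n -> (n <= m)%N.
  by move/asboolP => [b [Vb fb]]; apply: free_mod_le_span fb _ => i; apply: span_b'.
have [n /asboolP[b [Vb fb]] max] := ex_maxnP P0 Pm.
exists n, b; split=> // v Vv; apply: contrapT => nspan.
suff /max : P n.+1 by rewrite ltnn.
apply/asboolP; exists (fun i : 'I_n.+1 => oapp b v (unlift ord0 i)).
split; last exact: free_mod_extend fb nspan.
by move=> i; case: (unlift ord0 i) => [j|]; [apply: Vb | apply: Vv].
Qed.

(** A vector outside the span would extend [b'] to more free vectors than [b] has. *)
Lemma quotient_basis_of_free n (b b' : 'I_n -> E) : quotient_basis scale V W b ->
  (forall i, V (b' i)) -> free_mod b' -> quotient_basis scale V W b'.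
Proof.
move=> [Vb fb sb] Vb' fb'; split=> // v Vv; apply: contrapT => nspan.
suff : (n.+1 <= n)%N by rewrite ltnn.
apply: (free_mod_le_span (free_mod_extend fb' nspan) (b' := b)) => i.
by apply: sb; case: (unlift ord0 i) => [j|]; [apply: Vb' | apply: Vv].
Qed.

(** A relation with [c j] nonzero allows [b' j] to be eliminated, so that [n.-1] vectors would span
    the [n] free vectors of [b]. *)
Lemma quotient_basis_of_span n (b b' : 'I_n -> E) : quotient_basis scale V W b ->
  (forall i, V (b' i)) -> (forall v, V v -> span_mod b' v) -> quotient_basis scale V W b'.
Proof.
move=> [Vb fb sb] Vb' sb'; split=> // c Wc; apply: contrapT => /existsNP[j /eqP cj].
have n0 : (0 < n)%N by apply: leq_ltn_trans (ltn_ord j).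
suff : (n <= n.-1)%N by rewrite -ltnS prednK // ltnn.
apply: (free_mod_le_span fb (b' := b' \o lift j)) => i.
(* The multiple of the relation is chosen so that the coefficient of [b' j] becomes 0. *)
have [a Wa] := sb' _ (Vb i); exists (fun i' => a (lift j i') - a j / c j * c (lift j i')).
pose F i' := a i' - a j / c j * c i'.
suff -> : b i - lincomb (fun i' => F (lift j i')) (b' \o lift j) =
    (b i - lincomb a b') + scale (a j / c j) (lincomb c b').
  by apply: WD => //; apply: WZ.
have -> : lincomb (fun i' => F (lift j i')) (b' \o lift j) = lincomb F b'.
  rewrite /lincomb (bigD1_ord j) //= {2}/F mulfVK // subrr scale0x add0r.
  by [].
rewrite -addrA; congr (_ + _); rewrite /lincomb scale_sumr -sumrN -[in RHS]sumrN -big_split.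
apply: eq_bigr => i' _ /=; rewrite /F scaleDl opprD scaleA; congr (_ + _).
by rewrite -scaleN1 scaleA mulN1r opprK.
Qed.

End QuotientBasis.

(** * Binary forms and elimination *)

Section BinaryForms.
Variable k : closedFieldType.

(* The form of degree s in u and v that becomes p for u = 'X and v = 1; the
   coefficients of p beyond 'X^s are ignored. *)
Definition bform (A : comAlgType k) (s : nat) (p : {poly k}) (u v : A) : A :=
  \sum_(i < s.+1) p`_i *: (u ^+ i * v ^+ (s - i)).

Definition lin2 (A : comAlgType k) (u v : A) (ab : k * k) : A := ab.1 *: u + ab.2 *: v.

Lemma bform_mulX s (p : {poly k}) r : (size p <= s.+1)%N ->
  forall (A : comAlgType k) (u v : A),
  bform s.+1 (p * ('X - r%:P)) u v = lin2 u v (1, - r) * bform s p u v.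
Proof.
move=> sp A u v; rewrite /bform /lin2 /= scale1r scaleNr mulrBl.
have coefE i : (p * ('X - r%:P))`_i = (if i is j.+1 then p`_j else 0) - r * p`_i.
  by rewrite mulrBr coefB coefMX coefMC mulrC; case: i.
under eq_bigr do rewrite coefE scalerBl.
rewrite sumrB big_ord_recl scale0r add0r /=; congr (_ - _).
  rewrite mulr_sumr; apply: eq_bigr => i _.
  by rewrite /bump /= add1n subSS exprS -scalerAr -!mulrA.
rewrite big_ord_recr /= nth_default // mulr0 scale0r addr0 mulr_sumr.
apply: eq_bigr => i _; rewrite subSn; [|by rewrite -ltnS]; rewrite exprS -scalerAr -scalerAl scalerA [p`_i * r]mulrC.
by congr (_ *: _); rewrite mulrCA.
Qed.

(** A drop in the degree of [p] is a root at infinity and costs one factor [v]. *)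
Lemma bform_low s (p : {poly k}) : (size p <= s.+1)%N ->
  forall (A : comAlgType k) (u v : A), bform s.+1 p u v = lin2 u v (0, 1) * bform s p u v.
Proof.
move=> sp A u v; rewrite /bform /lin2 /= scale0r add0r scale1r big_ord_recr /=.
rewrite [p`__]nth_default // scale0r addr0 mulr_sumr; apply: eq_bigr => i _.
by rewrite subSn; [|by rewrite -ltnS]; rewrite exprS -scalerAr mulrCA.
Qed.

(** One factor is split off per degree: [v] if the degree of [p] is too small, [u - r v] for a root
    [r] otherwise. The factors are chosen before the algebra [A], as they serve both for two
    variables and for two linear forms in three variables. *)
Lemma bform_split s (p : {poly k}) : p != 0 -> (size p <= s.+1)%N ->
  exists L a, [/\ a != 0, forall ab, ab \in L -> ab != (0, 0) &
    forall (A : comAlgType k) (u v : A), bform s p u v = a *: \prod_(ab <- L) lin2 u v ab].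
Proof.
elim: s p => [|s IH] p p0 sp.
  exists [::], p`_0; split=> // [|A u v].
    by move: p0; rewrite [p]size1_polyC // polyC_eq0 coefC.
  by rewrite /bform big_ord1 big_nil mul1r.
have [sp'|sp'] := leqP (size p) s.+1.
  have [L [a [a0 hL E]]] := IH _ p0 sp'; exists ((0, 1) :: L), a; split=> // [ab|A u v].
    by rewrite inE => /orP[/eqP ->|/hL //]; rewrite xpair_eqE oner_eq0 andbF.
  by rewrite bform_low // E big_cons -scalerAr.
have : size p != 1%N by rewrite gtn_eqF // (leq_ltn_trans _ sp').
case/closed_rootP => r /factor_theorem[q Eq].
have q0 : q != 0 by apply: contra_neq p0 => q0; rewrite Eq q0 mul0r.
have sq : (size q <= s.+1)%N by move: sp; rewrite Eq size_Mmonic ?monicXsubC // size_XsubC addn2.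
have [L [a [a0 hL E]]] := IH _ q0 sq; exists ((1, - r) :: L), a; split=> // [ab|A u v].
  by rewrite inE => /orP[/eqP ->|/hL //]; rewrite xpair_eqE oner_eq0.
by rewrite Eq bform_mulX // E big_cons -scalerAr.
Qed.

Lemma binary_form_split (c : {mpoly k[2]}) d : c != 0 -> c \is d.-homog ->
  exists L a, [/\ a != 0, forall ab, ab \in L -> ab != (0, 0) &
    c = a *: \prod_(ab <- L) lin2 'X_ord0 'X_ord_max ab].
Proof.
move=> c0 hc; pose mon i j : 'X_{1..2} := (U_(ord0) *+ i + U_(ord_max) *+ j)%MM.
have mon0 i j : mon i j ord0 = i by rewrite /mon mnmDE !mulmnE !mnm1E /= mul1n mul0n addn0.
have monE (m : 'X_{1..2}) : m = mon (m ord0) (mdeg m - m ord0)%N.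
  apply/mnmP => i; rewrite mdegE !big_ord_recl big_ord0 addn0 addKn /mon mnmDE !mulmnE !mnm1E.
  have [j ->|->] := unliftP ord0 i; last by rewrite /= mul1n mul0n addn0.
  rewrite ord1 (_ : lift ord0 ord0 = ord_max); last exact: val_inj.
  by rewrite /= mul1n mul0n.
pose p := \poly_(i < d.+1) c@_(mon i (d - i)%N).
have Ec : c = bform d p 'X_ord0 'X_ord_max.
  apply/mpolyP => m; rewrite /bform linear_sum /=.
  have E i : (i < d.+1)%N -> (p`_i *: ('X_ord0 ^+ i * 'X_ord_max ^+ (d - i)))@_m =
      c@_m * (m == mon i (d - i)%N)%:R.
    move=> lt; rewrite !mpolyXn -mpolyXD mcoeffZ mcoeffX coef_poly lt eq_sym -/(mon _ _).
    by case: eqP => [->|]; rewrite ?mulr0.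
  under eq_bigr do rewrite E //.
  have [md|/(dhomog_nemf_coeff hc) ->] := eqVneq (mdeg m) d; last first.
    by rewrite big1 // => i _; rewrite mul0r.
  have lt : (m ord0 < d.+1)%N by rewrite ltnS -md mdegE big_ord_recl leq_addr.
  have Em : m = mon (m ord0) (d - m ord0)%N by rewrite -[in (d - _)%N]md -monE.
  rewrite (bigD1 (Ordinal lt)) //= -Em eqxx mulr1 big1 ?addr0 // => i.
  rewrite -val_eqE /= => ne; case: eqP => [E'|]; rewrite ?mulr0 //.
  by case/eqP: ne; rewrite E' mon0.
have p0 : p != 0.
  apply: contra_neq c0 => E; rewrite Ec E /bform big1 // => i _.
  by rewrite coef0 scale0r.
have [L [a [a0 hL E]]] := bform_split p0 (size_poly _ _).
by exists L, a; split=> //; rewrite {1}Ec E.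
Qed.

End BinaryForms.

Lemma meval_scale (k : fieldType) n (f : {mpoly k[n]}) d t v :
  f \is d.-homog -> f.@[fun i => t * v i] = t ^+ d * f.@[v].
Proof.
move=> hf; rewrite !mevalE mulr_sumr; apply: eq_big_seq => m hm.
have <- : mdeg m = d by rewrite -(dhomog_mf hf hm).
rewrite mulrCA; congr (_ * _); rewrite mdegE -prodrXr -big_split.
by apply: eq_bigr => i _; rewrite exprMn.
Qed.

(** * Elimination of the last variable *)

Section CommonFactor.
Variables (k : fieldType) (n : nat) (gs : seq {mpoly k[n]}).

(** If [l] divides [h], it cancels on both sides and is recorded in [T]. Otherwise, [l] being prime,
    it divides each cofactor [q] and cancels there. *)
Lemma peel_linear_factors (L : seq {mpoly k[n]}) h :
  (forall l, l \in L -> l != 0 /\ l \is 1.-homog) ->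
  (forall g, g \in gs -> exists q, (\prod_(l <- L) l) * g = q * h) ->
  exists h' T, [/\ h = h' * \prod_(l <- T) l, {subset T <= L} &
    forall g, g \in gs -> exists q, g = q * h'].
Proof.
elim: L h => [|l L IH] h hL hg.
  exists h, [::]; split=> //; first by rewrite big_nil mulr1.
  by move=> g /hg [q]; rewrite big_nil mul1r => ->; exists q.
have [l0 hl] := hL l (mem_head _ _).
have hL' l' : l' \in L -> l' != 0 /\ l' \is 1.-homog.
  by move=> h'; apply: hL; rewrite inE h' orbT.
have [[h1 Eh]|ndiv] := pselect (exists r, h = r * l).
  have [|h' [T [E1 sT hT]]] := IH h1 hL'.
    move=> g /hg[q]; rewrite big_cons Eh mulrA -mulrA mulrC => E; exists q.
    by apply: (mulIf l0); rewrite -E.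
  exists h', (l :: T); split=> //; first by rewrite Eh E1 big_cons -mulrA [l * _]mulrC.
  by move=> x; rewrite !inE => /orP[->//|/sT ->]; rewrite orbT.
have [|h' [T [E1 sT hT]]] := IH h hL'.
  move=> g /hg[q]; rewrite big_cons => E.
  have [|[r Er]|//] := linear_form_prime (p := q) (q := h) l0 hl.
    by exists (\prod_(j <- L) j * g); rewrite -E -mulrA mulrC.
  by exists r; apply: (mulfI l0); rewrite mulrA E Er [r * l]mulrC mulrA.
by exists h', T; split=> // x /sT; rewrite inE orbC => ->.
Qed.
End CommonFactor.

Section Elimination.
Variable k : closedFieldType.
Implicit Type gs : seq {mpoly k[3]}.

Definition homogeneous_gens gs := forall g, g \in gs -> exists d, g \is d.-homog.
Definition no_common_factor gs :=
  forall h : {mpoly k[3]}, (forall g, g \in gs -> exists q, g = q * h) -> (msize h <= 1)%N.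

Let x : {mpoly k[3]} := 'X_(widen_ord (leqnSn 2) ord0).
Let y : {mpoly k[3]} := 'X_(widen_ord (leqnSn 2) ord_max).

Let hx : x \is 1.-homog. Proof. exact: homogXU. Qed.
Let hy : y \is 1.-homog. Proof. exact: homogXU. Qed.

Let hlin2 ab : lin2 x y ab \is 1.-homog.
Proof. by apply: rpredD; apply: rpredZ. Qed.

Let lin2_neq0 ab : ab != (0, 0) -> lin2 x y ab != 0.
Proof.
case: ab => a b; apply: contra_neq => E.
have Em c : (lin2 x y (a, b))@_U_(c) = a * (widen_ord (leqnSn 2) ord0 == c)%:R
    + b * (widen_ord (leqnSn 2) ord_max == c)%:R.
  by rewrite mcoeffD !mcoeffZ !mcoeffXU.
have := Em (widen_ord (leqnSn 2) ord0); have := Em (widen_ord (leqnSn 2) ord_max).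
by rewrite E !mcoeff0 !eqxx !mulr1 !mulr0 addr0 add0r => <- <-.
Qed.

Lemma no_common_factor_neq0 gs : no_common_factor gs -> exists2 g, g \in gs & g != 0.
Proof.
move=> ncf; apply: contrapT => nex; suff : (msize x <= 1)%N by rewrite msizeX mdeg1.
apply: ncf => g gin; exists 0; rewrite mul0r; apply: contrapT => /eqP g0.
by apply: nex; exists g.
Qed.

(* Pseudo-division by an element of the ideal of least degree in z shows that
   this element divides every generator, up to a factor not involving z. *)
Lemma elimination_form gs : homogeneous_gens gs -> no_common_factor gs ->
  exists L : seq (k * k), (forall ab, ab \in L -> ab != (0, 0)) /\
    ideal_gen gs (\prod_(ab <- L) lin2 x y ab).
Proof.
move=> hgs ncf; set I := ideal_gen gs; have idI : ideal I := ideal_gen_ideal gs.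
have grI : graded I by apply: ideal_gen_graded.
(* The sizes in [z] of the nonzero forms of [I]; [h] attains the least one. *)
pose P s := `[< exists h d, [/\ I h, h != 0, h \is d.-homog & size (muni h) = s] >].
have exP : exists s, P s.
  have [g gin g0] := no_common_factor_neq0 ncf; have [d hg] := hgs _ gin.
  by exists (size (muni g)); apply/asboolP; exists g, d; split=> //; apply: mem_ideal_gen.
have [s /asboolP[h [dh [Ih h0 hh sh]]] mins] := ex_minnP exP.
have mh0 : muni h != 0 by apply: contra_neq h0 => E; rewrite -[h]muniK E rmorph0.
pose lc := lead_coef (muni h); have lc0 : lc != 0 by rewrite lead_coef_eq0.
have divI f : I f -> exists N q, zembed (lc ^+ N) * f = q * h.
  move=> If; have [N [q [a [sa Ea]]]] : exists N (q a : {poly {mpoly k[2]}}),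
      (size a < size (muni h))%N /\
      lc ^+ N *: muni f = q * muni h + a.
    exists (Pdiv.Idomain.scalp (muni f) (muni h)), (Pdiv.Idomain.divp (muni f) (muni h)).
    exists (Pdiv.Idomain.modp (muni f) (muni h)).
    by rewrite Pdiv.Idomain.ltn_modpN0 // Pdiv.Idomain.divp_eq.
  exists N, (of_muni q); pose r := of_muni a.
  have Er : zembed (lc ^+ N) * f = of_muni q * h + r.
    by rewrite -of_muniC -{1}[f]muniK -{1}[h]muniK -!rmorphM mul_polyC Ea rmorphD.
  have Ir : I r.
    have -> : r = zembed (lc ^+ N) * f - of_muni q * h by rewrite Er addrC addKr.
    by apply: idealB => //; apply: idealM.
  (* Each component of the remainder is a form of [I] of smaller size in [z] than [h], hence 0. *)
  suff r0 : r = 0 by rewrite Er r0 addr0.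
  rewrite (pihomog_partitionE (leqnn (msize r))) big1 // => d _; apply: contrapT => /eqP rd0.
  have : P (size (muni (pihomog mdeg d r))).
    by apply/asboolP; exists (pihomog mdeg d r), d; split=> //; [apply: grI | apply: pihomogP].
  move/mins; apply/negP; rewrite -ltnNge -sh; apply: leq_ltn_trans (size_muni_pihomog _ _) _.
  by rewrite of_muniK.
(* A single multiplier for all generators: the product of the powers of [lc] that each of them
   requires. *)
have [c c0 hc] : exists2 c, c != 0 & forall g, g \in gs -> exists q, zembed c * g = q * h.
  have: forall g, g \in gs -> I g by move=> g; apply: mem_ideal_gen.
  move: (gs) => s'; elim: s' => [|g s' IH] hI; first by exists 1 => //; apply: oner_neq0.
  have [|c c0 hc] := IH; first by move=> g' g'in; apply: hI; rewrite inE g'in orbT.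
  have [N [q Eq]] := divI _ (hI _ (mem_head _ _)).
  exists (lc ^+ N * c); first by rewrite mulf_neq0 // expf_neq0.
  move=> g'; rewrite rmorphM inE => /orP[/eqP ->|/hc[q' E]].
    by exists (zembed c * q); rewrite -[RHS]mulrA -Eq [RHS]mulrCA mulrA.
  by exists (zembed (lc ^+ N) * q'); rewrite -!mulrA -E.
(* Since [h] and the generators are forms, a nonzero component of [c] is again such a multiplier,
   and it splits into linear factors. *)
have [d cd0] : exists d, pihomog mdeg d c != 0.
  apply: contrapT => nex; case/eqP: c0.
  rewrite (pihomog_partitionE (leqnn (msize c))) big1 // => d _; apply: contrapT => /eqP cd0.
  by apply: nex; exists d.
have [L [a [a0 hL Ec]]] := binary_form_split cd0 (pihomogP _ _ _).
have Ez : zembed (pihomog mdeg d c) = a *: \prod_(l <- [seq lin2 x y ab | ab <- L]) l.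
  rewrite Ec zembedZ rmorph_prod big_map; congr (_ *: _); apply: eq_bigr => ab _.
  by rewrite /lin2 rmorphD /= !zembedZ /zembed !comp_mpolyXU -!tnth_nth !tnth_mktuple.
have [l|g gin|h' [T [Eh sT hT]]] := @peel_linear_factors _ _ gs [seq lin2 x y ab | ab <- L] h _ _.
- by case/mapP => ab /hL ab0 ->; split; [apply: lin2_neq0 | apply: hlin2].
- have [q Eq] := hc g gin; have [e he] := hgs g gin.
  have E : zembed (pihomog mdeg d c) * g = pihomog mdeg (d + e) (q * h).
    by rewrite -Eq (pihomogM _ _ he) leq_addl addnK zembed_pihomog.
  have {}Ez : \prod_(l <- [seq lin2 x y ab | ab <- L]) l = a^-1 *: zembed (pihomog mdeg d c).
    by rewrite Ez scalerA mulVf // scale1r.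
  rewrite Ez -scalerAl E (pihomogM _ _ hh); case: ifP => _.
    by exists (a^-1 *: pihomog mdeg (d + e - dh) q); rewrite scalerAl.
  by exists 0; rewrite scaler0 mul0r.
(* What remains of [h] divides every generator, hence is constant; so [h] is a constant times a
   product of linear forms in [x] and [y]. *)
have /msize1_polyC E := ncf h' hT.
have [T' hT' ET] : exists2 T', {subset T' <= L} & T = [seq lin2 x y ab | ab <- T'].
  elim: (T) sT => [|t T' IH] sT; first by exists [::].
  have [|T1 sT1 ->] := IH; first by move=> l lin; apply: sT; rewrite inE lin orbT.
  have /mapP[ab abin ->] := sT t (mem_head _ _); exists (ab :: T1) => // ab'.
  by rewrite inE => /orP[/eqP -> //|/sT1].
exists T'; split; first by move=> ab /hT'; apply: hL.
have b0 : h'@_0 != 0.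
  by apply: contra_neq h0 => b0; rewrite Eh E b0 mpolyC0 mul0r.
have -> : \prod_(ab <- T') lin2 x y ab = (h'@_0)^-1%:MP * h.
  by rewrite Eh {2}E mulrA -mpolyCM mulVf // mul1r ET big_map.
exact: idealM.
Qed.

End Elimination.

(** * A line that avoids the zeros of the ideal *)

Section GoodLine.
Variable k : closedFieldType.

Lemma ideal_add_principal (A : comNzRingType) (K : set A) l :
  ideal K -> ideal [set f | exists q, K (f - q * l)].
Proof.
move=> idK; split=> [|a b [q Kq] [r Kr]|c a [q Kq]] /=.
- by exists 0; rewrite mul0r subrr; apply: ideal0.
- by exists (q + r); rewrite mulrDl opprD addrACA; apply: idealD.
- by exists (c * q); rewrite -mulrA -mulrBr; apply: idealM.
Qed.

(** Pigeonhole: a monomial of degree at least [n * M] has some exponent at least [M]. *)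
Lemma homog_in_ideal_of_powers n (K : set {mpoly k[n]}) M : ideal K ->
  (forall i, K ('X_i ^+ M)) ->
  forall d f, (n * M <= d)%N -> f \is d.-homog -> (0 < n)%N -> K f.
Proof.
move=> idK KX d f le hf n0; rewrite [f]mpolyE big_seq; apply: (ideal_sum idK) => m hm.
rewrite -mul_mpolyC; apply: (idealM idK).
have md : mdeg m = d by rewrite -(dhomog_mf hf hm).
have [i le_i] : exists i, (M <= m i)%N.
  apply: contrapT => /forallNP nle.
  have lt i : (m i < M)%N by rewrite ltnNge; apply/negP/nle.
  move: le; rewrite -md mdegE leqNgt => /negP; apply.
  have -> : (n * M = \sum_(i < n) M)%N by rewrite sum_nat_const card_ord.
  rewrite (bigD1 (Ordinal n0)) //= [X in (_ < X)%N](bigD1 (Ordinal n0)) //= -addSn.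
  by apply: leq_add; [apply: lt | apply: leq_sum => i _; apply/ltnW/lt].
rewrite mpolyXE_id (bigD1 i) //= -(subnK le_i) exprD -mulrA.
by apply: (idealM idK); apply: (ideal_mulr idK).
Qed.

Implicit Type gs : seq {mpoly k[3]}.

(** Modulo [I] and [x - t y], for [t] off the roots of the eliminated form, that form becomes a
    nonzero multiple of a power of [y]. So [y] is nilpotent, then [x], and then [z] by means of
    [g]. *)
Lemma good_line_monic gs g : homogeneous_gens gs -> no_common_factor gs ->
  g \in gs -> g.@[fun i => (i == ord_max)%:R] != 0 ->
  exists l N, l \is [in k[3], 1.-homog] /\
    forall d f, (N <= d)%N -> f \is d.-homog -> exists q, ideal_gen gs (f - q * l).
Proof.
move=> hgs ncf gin gP; have [m hg] := hgs g gin.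
have [L [hL IL]] := elimination_form hgs ncf.
set x := 'X_(widen_ord (leqnSn 2) ord0) in IL; set y := 'X_(widen_ord (leqnSn 2) ord_max) in IL.
pose P : {poly k} := \prod_(ab <- L) (ab.1 *: 'X + ab.2%:P).
have P0 : P != 0.
  rewrite /P big_seq prodf_seq_neq0; apply/allP => ab abin; apply/implyP => /hL.
  apply: contra_neq; case: ab {abin} => a b /= E.
  have := congr1 (fun p : {poly k} => p`_1) E; have := congr1 (fun p : {poly k} => p`_0) E.
  by rewrite !coefD !coefZ !coefX !coefC /= !mulr0 !mulr1 add0r addr0 => -> ->.
have [t Pt] := poly_nonroot P0.
pose l := x - t%:MP * y; pose I := ideal_gen gs; pose K := [set f | exists q, I (f - q * l)].
have idI : ideal I := ideal_gen_ideal gs.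
have idK : ideal K := ideal_add_principal l idI.
have Kl : K l by exists 1; rewrite mul1r subrr; apply: (ideal0 idI).
have IK f : I f -> K f by move=> If; exists 0; rewrite mul0r subr0.
exists l; set n := size L.
have Ky : K (y ^+ n).
  have E : K (\prod_(ab <- L) lin2 x y ab - \prod_(ab <- L) ((ab.1 * t + ab.2)%:MP * y)).
    apply: (big_rec2 (fun a b => K (a - b))) => [|ab a b _ Kab].
      by rewrite subrr; apply: (ideal0 idK).
    apply: (ideal_congrM idK) => //.
    have -> : lin2 x y ab - (ab.1 * t + ab.2)%:MP * y = (ab.1)%:MP * l.
      rewrite /lin2 /l -!mul_mpolyC mpolyCD mpolyCM mulrDl mulrBr opprD mulrA.
      by rewrite addrACA subrr addr0.
    exact: (idealM idK).
  have [KE' _] := ideal_congr idK E; move: (KE' (IK _ IL)).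
  rewrite big_split /= big_const_seq count_predT iter_mulr_1 -rmorph_prod /= => KE.
  have PE : \prod_(ab <- L) (ab.1 * t + ab.2) = P.[t].
    by rewrite /P horner_prod; apply: eq_bigr => ab _; rewrite !hornerE.
  move: KE; rewrite PE => /(idealM idK (P.[t]^-1)%:MP).
  by rewrite mulrA -mpolyCM mulVf // mul1r.
have Kx : K (x ^+ n).
  have : K (x ^+ n - (t%:MP * y) ^+ n) by apply: (ideal_congrX idK).
  by move=> E; have [_] := ideal_congr idK E; apply; rewrite exprMn; apply: (idealM idK).
have Kz : K ('X_ord_max ^+ (m * n)).
  (* Modulo [K] and [y] both [x] and [y] vanish, so [g] reduces to a nonzero constant times the
     [m]-th power of [z]. *)
  pose K3 := [set f | exists b, K (f - b * y)].
  have idK3 : ideal K3 := ideal_add_principal y idK.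
  have : K3 ('X_ord_max ^+ m).
    have E : K3 ((g \mPo [tuple 'X_i | i < 3]) -
        (g \mPo [tuple 'X_ord_max * ((i == ord_max)%:R)%:MP | i < 3])).
      apply: comp_mpoly_congr => // i; rewrite !tnth_mktuple.
      have [j ->|->] := unliftP ord_max i; last first.
        by rewrite eqxx mpolyC1 mulr1 subrr; apply: (ideal0 idK3).
      rewrite eq_sym (negbTE (neq_lift _ _)) mpolyC0 mulr0 subr0.
      have [j' ->|->] := unliftP ord_max j.
        exists t%:MP; rewrite [lift _ _](_ : _ = widen_ord (leqnSn 2) ord0) //.
        by apply: val_inj; rewrite /= ord1.
      exists 1; rewrite mul1r [lift _ _](_ : _ = widen_ord (leqnSn 2) ord_max) ?subrr.
        exact: (ideal0 idK).
      exact: val_inj.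
    move: E; rewrite comp_mpoly_id (comp_homog_point _ _ hg) => E'; have [E _] := ideal_congr idK3 E'.
    have /E/(ideal_mulr idK3 (g.@[fun i => (i == ord_max)%:R]^-1)%:MP) : K3 g.
      by exists 0; rewrite mul0r subr0; apply/IK/mem_ideal_gen.
    by rewrite -mulrA -mpolyCM divff // mulr1.
  case=> b /(ideal_congrX idK n); rewrite exprMn -exprM => E'; have [_] := ideal_congr idK E'; apply.
  exact: (idealM idK).
(* The exponent [n + m * n] serves for all three variables. *)
exists (3 * (n + m * n))%N; split=> [|d f le hf].
  by apply: rpredB; [apply: homogXU | rewrite mul_mpolyC; apply/rpredZ/homogXU].
apply: (homog_in_ideal_of_powers idK _ le hf) => // i.
have [j ->|->] := unliftP ord_max i; last by rewrite exprD; apply: (idealM idK).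
have [j' ->|->] := unliftP ord_max j; rewrite exprD; apply: (ideal_mulr idK).
  rewrite [lift _ _](_ : _ = widen_ord (leqnSn 2) ord0) //.
  by apply: val_inj; rewrite /= ord1.
by rewrite [lift _ _](_ : _ = widen_ord (leqnSn 2) ord_max) //; apply: val_inj.
Qed.

(* After a translation x -> x + a z, y -> y + b z one of the generators does
   not vanish at (0 : 0 : 1). *)
Lemma good_line gs : homogeneous_gens gs -> no_common_factor gs ->
  exists l N, l \is [in k[3], 1.-homog] /\
    forall d f, (N <= d)%N -> f \is d.-homog -> exists q, ideal_gen gs (f - q * l).
Proof.
move=> hgs ncf; have [g gin g0] := no_common_factor_neq0 ncf; have [m hg] := hgs g gin.
(* The factor [z] keeps the point off the line [z = 0], so that it can be scaled to [z = 1]. *)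
have [v] : exists v, (g * 'X_ord_max).@[v] != 0.
  by apply: mpoly_nonzero_point; rewrite mulf_neq0 // -msize_poly_eq0 msizeX.
rewrite mevalM mevalXU mulf_eq0 negb_or => /andP[gv vz].
pose w i := v i / v ord_max.
have gw : g.@[w] != 0.
  have E : g.@[v] = v ord_max ^+ m * g.@[w].
    by rewrite -(meval_scale _ _ hg); apply: meval_eq => i; rewrite /w mulrCA divff // mulr1.
  by apply: contra_neq gv => gw; rewrite E gw mulr0.
(* Translation by [s] times [w] in the chart [z = 1]; its inverse is [S (- s)]. *)
pose S (s : k) := [tuple 'X_i + ((i != ord_max)%:R * s * w i)%:MP * 'X_ord_max : {mpoly k[3]} | i < 3].
have SK s f : (f \mPo S s) \mPo S (- s) = f.
  rewrite comp_mpoly_comp -[RHS]comp_mpoly_id; congr (_ \mPo _); apply: eq_mktuple => i.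
  rewrite tnth_mktuple comp_mpolyD rmorphM /= comp_mpolyC !comp_mpolyXU -!tnth_nth !tnth_mktuple.
  rewrite eqxx /= !mul0r addr0 -addrA -mulrDl -mpolyCD mulrN mulNr addNr.
  by rewrite mpolyC0 mul0r addr0.
have hS s i : tnth (S s) i \is 1.-homog.
  rewrite tnth_mktuple mul_mpolyC; apply: rpredD; first exact: homogXU.
  by apply/rpredZ/homogXU.
pose gs' := [seq f \mPo S 1 | f <- gs].
have [||||l [N [hl hN]]] := good_line_monic (gs := gs') (g := g \mPo S 1).
- by move=> _ /mapP[f /hgs[d hf] ->]; exists d; apply: comp_homog.
- move=> h hdiv; have : (msize (h \mPo S (- 1)%R) <= 1)%N.
    apply: ncf => f fin; have [q Eq] := hdiv _ (map_f _ fin).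
    by exists (q \mPo S (- 1)); rewrite -[f](SK 1) Eq rmorphM.
  move/msize1_polyC => E; rewrite -[h](SK (- 1)) E opprK comp_mpolyC.
  by rewrite msizeC leq_b1.
- exact: map_f.
- rewrite comp_mpoly_meval; apply: contra_neq gw => <-; apply: meval_eq => i.
  rewrite tnth_mktuple mevalD mevalM mevalC !mevalXU eqxx !mulr1.
  case: eqVneq => [->|_]; last by rewrite mul1r add0r.
  by rewrite mul0r addr0 /w divff.
exists (l \mPo S (- 1)), N; split=> [|d f le hf]; first exact: comp_homog.
have [q Iq] := hN d (f \mPo S 1) le (comp_homog (hS 1) hf).
exists (q \mPo S (- 1)); rewrite -[f](SK 1) -rmorphM -rmorphB.
have idT : ideal [set f : {mpoly k[3]} | ideal_gen gs (f \mPo S (- 1))].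
  by apply: ideal_preimage; apply: ideal_gen_ideal.
apply: (ideal_gen_min idT _ Iq) => _ /mapP[f' fin ->] /=.
by rewrite SK; apply: mem_ideal_gen.
Qed.

End GoodLine.

(** * The Hilbert function *)

Section Hilbert.
Variables (k : closedFieldType) (I : set {mpoly k[3]}) (l : {mpoly k[3]}) (N : nat).
Hypotheses (idI : ideal I) (grI : graded I) (hl : l \is 1.-homog).
Hypothesis surj_l : forall d f, (N <= d)%N -> f \is d.-homog -> exists q, I (f - q * l).

Let scale (c : k) (f : {mpoly k[3]}) := c *: f.
Let sDl a b f : scale (a + b) f = scale a f + scale b f. Proof. exact: scalerDl. Qed.
Let sDr a f g : scale a (f + g) = scale a f + scale a g. Proof. exact: scalerDr. Qed.
Let sA a b f : scale a (scale b f) = scale (a * b) f. Proof. exact: scalerA. Qed.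
Let s1 f : scale 1 f = f. Proof. exact: scale1r. Qed.
Let I0 : I 0 := ideal0 idI.
Let ID f g : I f -> I g -> I (f + g). Proof. exact: (idealD idI). Qed.
Let IZ a f : I f -> I (scale a f).
Proof. by rewrite /scale -mul_mpolyC; apply: (idealM idI). Qed.

Let deg_part n := [set f : {mpoly k[3]} | f \is n.-homog].

(** The monomials of degree at most [n] span, so the dimension is finite and [hilbert_fun] is not a
    default value. *)
Lemma hilbert_basis n : exists b : 'I_(hilbert_fun I n) -> {mpoly k[3]},
  quotient_basis scale (deg_part n) I b.
Proof.
suff [h [b hb]] : exists h (b : 'I_h -> {mpoly k[3]}), quotient_basis scale (deg_part n) I b.
  by rewrite /hilbert_fun (quotient_dimE sDl sDr sA s1 I0 ID IZ hb); exists b.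
pose T : finType := 'X_{1..3 < n.+1}.
apply: (quotient_basis_exists sDl sDr sA s1 I0 ID IZ (m := #|T|)
  (b' := fun i => 'X_[bmnm (enum_val i : T)])) => f hf.
exists (fun i => f@_(bmnm (enum_val i : T))).
rewrite (_ : lincomb _ _ _ = f) ?subrr //.
have ms : (msize f <= n.+1)%N.
  rewrite msizeE; apply/bigmax_leqP_seq => m hm _.
  by rewrite ltnS -(dhomog_mf hf hm).
rewrite {2}(mpolywE ms) /lincomb /scale.
rewrite [RHS](reindex (@enum_val T T)) //=; apply: onW_bij; exact: enum_val_bij.
Qed.

Lemma graded_sub_mull n f q : I (f - q * l) -> f \is n.+1.-homog ->
  I (f - pihomog mdeg n q * l).
Proof.
move=> Ifq hf; have := grI n.+1 Ifq.
by rewrite linearB /= (pihomogM _ _ hl) /= subn1 /= pihomog_dE.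
Qed.

Lemma basis_mull n (b : 'I_(hilbert_fun I n) -> {mpoly k[3]}) : (N <= n)%N ->
  quotient_basis scale (deg_part n) I b ->
  forall v, deg_part n.+1 v -> span_mod scale I (fun i => b i * l) v.
Proof.
move=> le [hb fb sb] v hv; have [q Iq] := surj_l (leqW le) hv.
have {}Iq := graded_sub_mull Iq hv.
have [c Ic] := sb _ (pihomogP mdeg n q); exists c.
rewrite -(subrK (pihomog mdeg n q * l) v) -addrA; apply: ID => //.
rewrite (_ : lincomb _ _ _ = lincomb scale c b * l); last first.
  by rewrite /lincomb mulr_suml; apply: eq_bigr => i _; rewrite /scale scalerAl.
by rewrite -mulrBl; apply: (ideal_mulr idI).
Qed.

Lemma hilbert_nonincreasing n : (N <= n)%N -> (hilbert_fun I n.+1 <= hilbert_fun I n)%N.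
Proof.
move=> le; have [b hb] := hilbert_basis n; have [b' [hb' fb' sb']] := hilbert_basis n.+1.
apply: (free_mod_le_span sDl sDr sA s1 I0 ID IZ fb') => i.
exact: (basis_mull le hb (hb' i)).
Qed.

(** From [N] on the values do not increase, so they are constant once their minimum is attained. *)
Lemma hilbert_stable : exists N', (N <= N')%N /\
  forall n, (N' <= n)%N -> hilbert_fun I n = bour I.
Proof.
pose P v := `[< exists n, (N <= n)%N /\ hilbert_fun I n = v >].
have exP : exists v, P v by exists (hilbert_fun I N); apply/asboolP; exists N.
have [v /asboolP[N' [leN hN']] minv] := ex_minnP exP.
have E n : (N' <= n)%N -> hilbert_fun I n = v.
  move/subnK <-; elim: (n - N')%N => [//|j IH].
  apply/eqP; rewrite eqn_leq; apply/andP; split.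
    by rewrite -IH addSn; apply: hilbert_nonincreasing; rewrite (leq_trans leN) // leq_addl.
  apply: minv; apply/asboolP; exists (j.+1 + N')%N; split=> //.
  by rewrite (leq_trans leN) // leq_addl.
exists N'; split=> // n le; rewrite E // /bour.
case: xgetP => [c _ [N1 h1]|/(_ v) nex]; last by case: nex; exists N'.
by rewrite -(h1 (maxn N1 N')) ?leq_maxl // E ?leq_maxr.
Qed.

(** Multiplication by [l] is onto between spaces of the same finite dimension: the images of a basis
    span, hence form a basis. *)
Lemma eventually_cancel_line N' : (N <= N')%N ->
  (forall n, (N' <= n)%N -> hilbert_fun I n = bour I) ->
  forall n f, (N' <= n)%N -> f \is n.-homog -> I (f * l) -> I f.
Proof.
move=> leN E n f le hf Ifl; have [b hb] := hilbert_basis n.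
have leNn := leq_trans leN le; have sl := basis_mull leNn hb.
have [b' hb'] := hilbert_basis n.+1.
have {b' hb'} [b' hb'] : exists b' : 'I_(hilbert_fun I n) -> _,
    quotient_basis scale (deg_part n.+1) I b'.
  by rewrite E // -(E n.+1) ?leqW //; exists b'.
have [|_ fl _] := quotient_basis_of_span sDl sDr sA s1 I0 ID IZ hb' _ sl.
  move=> i; rewrite /deg_part /= -[in n.+1](addn1 n); apply: dhomogM => //.
  by case: hb => hb _ _; apply: hb.
have [_ _ sb] := hb; have [c Ic] := sb f hf.
have : I (lincomb scale c (fun i => b i * l)).
  rewrite (_ : lincomb _ _ _ = lincomb scale c b * l); last first.
    by rewrite /lincomb mulr_suml; apply: eq_bigr => i _; rewrite /scale scalerAl.
  have := ideal_mulr idI l Ic; rewrite mulrBl => If.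
  by have [+ _] := ideal_congr idI If; apply.
move/fl => c0; move: Ic; rewrite /lincomb big1 ?subr0 // => i _.
by rewrite c0 /scale scale0r.
Qed.

End Hilbert.

(** * Common eigenvectors of multiplication by the coordinates *)

Section EigenPoint.
Variables (k : closedFieldType) (I : set {mpoly k[3]}) (l : {mpoly k[3]}) (N : nat).
Hypotheses (idI : ideal I) (grI : graded I) (hl : l \is 1.-homog).
Hypothesis hilbN : forall n, (N <= n)%N -> hilbert_fun I n = bour I.
Hypothesis cancel_l : forall n f, (N <= n)%N -> f \is n.-homog -> I (f * l) -> I f.

Lemma free_mod_le_bour n r (u : 'I_r -> {mpoly k[3]}) : (N <= n)%N ->
  (forall i, u i \is n.-homog) ->
  (forall c : 'I_r -> k, I (\sum_i c i *: u i) -> forall i, c i = 0) -> (r <= bour I)%N.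
Proof.
move=> le hu free_u; rewrite -(hilbN le); have [b [_ _ sb]] := hilbert_basis idI n.
have IZ a f : I f -> I (a *: f) by move=> If; rewrite -mul_mpolyC; apply: idealM.
have sDl (a1 a2 : k) (f : {mpoly k[3]}) : (a1 + a2) *: f = a1 *: f + a2 *: f by apply: scalerDl.
apply: (free_mod_le_span sDl (@scalerDr _ _) (@scalerA _ _) (@scale1r _ _)
  (ideal0 idI) (idealD idI) IZ free_u) => i.
by apply: sb; apply: hu.
Qed.

Lemma cancel_lX n f s : (N <= n)%N -> f \is n.-homog -> I (f * l ^+ s) -> I f.
Proof.
move=> le; elim: s n le f => [|s IH] n le f hf; first by rewrite mulr1.
rewrite exprS mulrA => /(IH n.+1 (leqW le)) If; apply: (cancel_l le hf); apply: If.
by rewrite -[in n.+1](addn1 n); apply: dhomogM.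
Qed.

(** Such a [w] is a candidate eigenvector modulo [I]; its degree is large enough for [l] to be
    cancelled. *)
Definition multiple_outside (v w : {mpoly k[3]}) : Prop :=
  [/\ ~ I w, exists r, w = r * v & exists2 n, (N <= n)%N & w \is n.-homog].

(* By the bound on the Hilbert function, a nontrivial binary form in x and l
   multiplies v into I; split it into linear factors and stop at the first one
   that matters. *)
Lemma eigen_multiple (x v : {mpoly k[3]}) n : x \is 1.-homog -> (N <= n)%N ->
  v \is n.-homog -> ~ I v ->
  exists w a, multiple_outside v w /\ I ((x - a *: l) * w).
Proof.
move=> hx le hv nIv; pose s := bour I.
(* These [s.+1] forms share a degree in which the quotient by [I] has dimension [s], so they are
   dependent modulo [I]. *)
pose u (i : 'I_s.+1) := x ^+ i * l ^+ (s - i) * v.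
have hu i : u i \is (s + n).-homog.
  have lei : (i <= s)%N by rewrite -ltnS.
  apply: dhomogM hv; apply: (homogM_eq (dhomogMn i hx) (dhomogMn (s - i) hl)).
  by rewrite !mul1n subnKC.
have [c Ic [i0 ci0]] : exists2 c : 'I_s.+1 -> k, I (\sum_i c i *: u i) & exists i, c i <> 0.
  apply: contrapT => nex; suff : (s.+1 <= bour I)%N by rewrite ltnn.
  apply: (free_mod_le_bour _ hu) => [|c Ic i]; first by rewrite (leq_trans le) ?leq_addl.
  by apply: contrapT => ci; apply: nex; exists c => //; exists i.
pose p := \poly_(i < s.+1) c (inord i).
have p0 : p != 0.
  apply/negP => /eqP E; apply: ci0; have := congr1 (fun q : {poly k} => q`_i0) E.
  by rewrite coef_poly ltn_ord coef0 inord_val.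
have [L [a [a0 hL EL]]] := bform_split p0 (size_poly _ _).
have {Ic} IL : I ((\prod_(ab <- L) lin2 x l ab) * v).
  rewrite -[X in I X]scale1r -(mulVf a0) -scalerA -mul_mpolyC scalerAl -EL.
  apply: (idealM idI); move: Ic; congr I; rewrite /bform mulr_suml; apply: eq_bigr => i _.
  by rewrite coef_poly ltn_ord inord_val scalerAl.
have hlin ab : lin2 x l ab \is 1.-homog by apply: rpredD; apply: rpredZ.
(* Factors are removed while the remaining product times [v] stays in [I]; this stops before [v]
   itself is reached. *)
elim: L hL IL {p p0 a a0 EL} => [|ab L IH] hL; first by rewrite big_nil mul1r.
set w := (\prod_(ab <- L) lin2 x l ab) * v; rewrite big_cons -mulrA -/w => Iw.
have [/IH|nIw] := pselect (I w); first by apply=> ab' h'; apply: hL; rewrite inE h' orbT.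
have hw : w \is (size L + n).-homog.
  apply: dhomogM hv; rewrite -sum1_size.
  by apply: (@homog_cond_prod _ _ _ _ _ _ (fun=> 1%N)).
have leL : (N <= size L + n)%N by rewrite (leq_trans le) ?leq_addl.
(* A factor without [x] is a multiple of [l], and cancelling it would put [w] in [I]. *)
have a0 : ab.1 != 0.
  apply/negP => /eqP E; have := hL _ (mem_head _ _); case: ab E Iw {hL} => a b /= -> Iw.
  rewrite xpair_eqE eqxx /= => b0; apply: nIw; apply: (cancel_l leL hw).
  have := idealM idI b^-1%:MP Iw; rewrite /lin2 /= scale0r add0r -scalerAl -mul_mpolyC mulrA.
  by rewrite -mpolyCM mulVf // mul1r mulrC.
exists w, (- (ab.1^-1 * ab.2)); split.
  by split=> //; [eexists; reflexivity | exists (size L + n)%N].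
have := idealM idI ab.1^-1%:MP Iw; rewrite mulrA mul_mpolyC /lin2 scalerDr !scalerA mulVf //.
by rewrite scale1r scaleNr opprK.
Qed.

(** The variables are treated in turn: since multiplications commute, a multiple of [w] keeps the
    eigenvalues already found. *)
Lemma eigen_point v n : (N <= n)%N -> v \is n.-homog -> ~ I v ->
  exists w (p : 'I_3 -> k), multiple_outside v w /\ forall i, I (('X_i - p i *: l) * w).
Proof.
move=> le hv nIv.
suff [w [p [hw Ip]]] : exists w (p : 'I_3 -> k), multiple_outside v w /\
    forall i, i \in enum 'I_3 -> I (('X_i - p i *: l) * w).
  by exists w, p; split=> // i; apply: Ip; rewrite mem_enum.
elim: (enum 'I_3) => [|j s [w [p [[nIw [r Er] [m lem hw]] Ip]]]].
  exists v, (fun=> 0); split=> //; split=> //; last by exists n.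
  by exists 1; rewrite mul1r.
have [w' [a [[nIw' [r' Er'] hw'] Ia]]] := eigen_multiple (homogXU _ j) lem hw nIw.
exists w', (fun i => if i == j then a else p i); split.
  by split=> //; exists (r' * r); rewrite Er' Er mulrA.
move=> i; rewrite inE; case: eqVneq => [-> //|_] /= iin.
by rewrite Er' mulrCA; apply: (idealM idI); apply: Ip.
Qed.

(** Modulo the ideal of polynomials that multiply [w] into [I], each ['X_i] equals [p i *: l]; this
    is substituted in [f]. *)
Lemma eigen_eval w (p : 'I_3 -> k) f m : (forall i, I (('X_i - p i *: l) * w)) ->
  f \is m.-homog -> I ((f - f.@[p] *: l ^+ m) * w).
Proof.
move=> Ip hf; have := @comp_mpoly_congr _ _ _ _ (ideal_colon w idI)
  [tuple 'X_i | i < 3] [tuple l * (p i)%:MP | i < 3] f.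
rewrite comp_mpoly_id (comp_homog_point _ _ hf) mulrC mul_mpolyC; apply=> i.
by rewrite !tnth_mktuple mulrC mul_mpolyC; apply: Ip.
Qed.

(** If [p] were 0, [l] would multiply [w] into [I]; if a form of [I] did not vanish at [p], a power
    of [l] would. Both contradict the cancellation of [l]. *)
Lemma eigen_point_zero w (p : 'I_3 -> k) n : (N <= n)%N -> w \is n.-homog -> ~ I w ->
  (forall i, I (('X_i - p i *: l) * w)) ->
  (exists i, p i != 0) /\ forall f, I f -> f.@[p] = 0.
Proof.
move=> le hw nIw Ip; split.
  apply: contrapT => /forallNP p0; apply: nIw; apply: (cancel_l le hw).
  have := eigen_eval Ip hl; rewrite [l in l.@[_]](linear_form_sum hl) linear_sum /=.
  rewrite big1 ?scale0r ?subr0 => [|i _]; first by rewrite mulrC.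
  by rewrite mevalZ mevalXU; have /negP/negPn/eqP -> := p0 i; rewrite mulr0.
move=> f If; rewrite (pihomog_partitionE (leqnn (msize f))) linear_sum big1 //= => d _.
apply: contrapT => /eqP fp; apply: nIw; apply: (cancel_lX (s := d) le hw).
have := eigen_eval Ip (pihomogP mdeg d f); rewrite mulrBl => E.
have [+ _] := ideal_congr idI E; move=> /(_ (ideal_mulr idI _ (grI d If))).
move/(idealM idI (pihomog mdeg d f).@[p]^-1%:MP).
by rewrite -scalerAl -mul_mpolyC mulrA -mpolyCM mulVf // mul1r mulrC.
Qed.

(** Turns local membership at the zeros of [I] into membership in large degree; [J] will be the set
    of polynomials vanishing at these zeros. *)
Lemma homog_sub_of_local (J : set {mpoly k[3]}) : (forall c f, J f -> J (c * f)) ->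
  (forall (p : 'I_3 -> k), (exists i, p i != 0) -> (forall f, I f -> f.@[p] = 0) ->
    forall n f, f \is n.-homog -> J f -> exists s m, [/\ s \is m.-homog, s.@[p] != 0 & I (s * f)]) ->
  forall n f, (N <= n)%N -> f \is n.-homog -> J f -> I f.
Proof.
move=> JM hJ n f le hf Jf; apply: contrapT => nIf.
have [w [p [[nIw [r Er] [m lem hw]] Ip]]] := eigen_point le hf nIf.
have [p0 pI] := eigen_point_zero lem hw nIw Ip.
have [|s [e [hs sp Is]]] := hJ p p0 pI m w hw; first by rewrite Er; apply: JM.
apply: nIw; apply: (cancel_lX (s := e) lem hw).
have := eigen_eval Ip hs; rewrite mulrBl => E.
have [+ _] := ideal_congr idI E; move=> /(_ Is) /(idealM idI s.@[p]^-1%:MP).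
by rewrite -scalerAl -mul_mpolyC mulrA -mpolyCM mulVf // mul1r mulrC.
Qed.

End EigenPoint.

(** * Points and interpolation *)

Section Points.
Variable k : fieldType.
Implicit Types P Q : P2 k.

Lemma chartP P : coords P (chart P) = 1 /\ forall j : 'I_3, (chart P < j)%N -> coords P j = 0.
Proof.
rewrite /coords /chart; case: P => v /=; case: pickP => [i /andP[/eqP vi /forallP h] _|no].
  by split=> // j /= lt; have := h j; rewrite lt /= => /eqP.
by move=> /existsP[i]; rewrite no.
Qed.

(** The vanishing minors force the last nonzero coordinates, both equal to 1, to have the same
    index; the minors through that index then give equality. *)
Lemma P2_proportional P Q :
  (forall i j, coords P i * coords Q j = coords P j * coords Q i) -> P = Q.
Proof.
move=> prop; have [P1 P0] := chartP P; have [Q1 Q0] := chartP Q.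
have E : chart P = chart Q.
  apply: val_inj; case: (ltngtP (chart P) (chart Q)) => // lt.
    have := prop (chart P) (chart Q); rewrite P1 Q1 (P0 _ lt) mul0r mul1r => /eqP.
    by rewrite oner_eq0.
  have := prop (chart P) (chart Q); rewrite P1 Q1 (Q0 _ lt) mulr0 mul1r => /eqP.
  by rewrite oner_eq0.
apply: val_inj; apply/rowP => j; have := prop (chart P) j.
by rewrite P1 E Q1 mul1r mulr1 /coords => ->.
Qed.

Lemma P2_normalize (p : 'I_3 -> k) : (exists i, p i != 0) ->
  exists Q t, t != 0 /\ forall i, p i = t * coords Q i.
Proof.
case=> i0 pi0; pose i := [arg max_(j > i0 | p j != 0%R) (val j)]%N.
have [pi imax] : p i != 0 /\ forall j, p j != 0 -> (j <= i)%N.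
  by rewrite /i; case: arg_maxnP => // i' h1 h2; split.
pose v : 'rV[k]_3 := \row_j (p j / p i).
have nv : normalized v.
  apply/existsP; exists i; rewrite /last_nonzero_is1 mxE divff // eqxx /=.
  apply/forallP => j; apply/implyP => lt; rewrite mxE mulf_eq0 -[p j == 0]negbK.
  by apply/orP; left; apply/negP => /imax; rewrite leqNgt lt.
exists (exist _ v nv), (p i); split=> // j.
by rewrite /coords /= mxE mulrCA divff // mulr1.
Qed.

Lemma meval_coords (f : {mpoly k[3]}) d (p : 'I_3 -> k) t Q : f \is d.-homog ->
  (forall i, p i = t * coords Q i) -> f.@[p] = t ^+ d * f.@[coords Q].
Proof. by move=> hf E; rewrite -(meval_scale _ _ hf); apply: meval_eq. Qed.

(** Take a nonzero minor of the coordinates of [P] and [Q], with the coordinates of [P] replaced by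
    variables. *)
Lemma separating_form P Q : P <> Q ->
  exists2 l : {mpoly k[3]}, l \is 1.-homog & l.@[coords Q] = 0 /\ l.@[coords P] != 0.
Proof.
move=> ne; have /existsNP[i /existsNP[j /eqP nij]] :
    ~ forall i j, coords P i * coords Q j = coords P j * coords Q i.
  by move=> prop; apply: ne; apply: P2_proportional.
exists (coords Q j *: 'X_i - coords Q i *: 'X_j).
  by apply: rpredB; apply/rpredZ/homogXU.
rewrite !mevalB !mevalZ !mevalXU mulrC subrr; split=> //.
by rewrite subr_eq0 mulrC [X in _ != X]mulrC.
Qed.

(** A product of forms separating [P] from the other points, padded to degree [n] with a coordinate
    equal to 1 at [P]. *)
Lemma interpolation_form r (Q : 'I_r -> P2 k) P n : (r <= n)%N ->
  exists E : {mpoly k[3]}, [/\ E \is n.-homog, E.@[coords P] != 0 &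
    forall j, Q j <> P -> E.@[coords (Q j)] = 0].
Proof.
move=> le; have [P1 _] := chartP P.
have sep j : exists l : {mpoly k[3]}, [/\ l \is 1.-homog, l.@[coords P] != 0 &
    Q j <> P -> l.@[coords (Q j)] = 0].
  have [->|ne] := pselect (Q j = P).
    by exists 'X_(chart P); split=> //; [apply: homogXU | rewrite mevalXU P1 oner_neq0].
  have [l hl [l0 l1]] := separating_form (nesym ne).
  by exists l.
have [L hL] := choice sep.
exists ('X_(chart P) ^+ (n - r) * \prod_j L j); split.
- apply: (homogM_eq (dhomogMn (n - r) (homogXU _ _)) (e := \sum_(j < r) 1%N)).
    by apply: (@homog_cond_prod _ _ _ _ _ _ (fun=> 1%N)) => j _; case: (hL j).
  by rewrite mul1n sum_nat_const card_ord muln1 subnK.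
- rewrite mevalM rmorphXn /= mevalXU P1 expr1n mul1r rmorph_prod /=.
  by apply/prodf_neq0 => j _; case: (hL j).
- move=> j ne; rewrite mevalM rmorph_prod /= (bigD1 j) //=.
  by case: (hL j) => _ _ -> //; rewrite mul0r mulr0.
Qed.

End Points.

(** * Zeros of the ideal and the value of the Hilbert function *)

Definition vanishes (k : fieldType) (S : set (P2 k)) (f : {mpoly k[3]}) : Prop :=
  forall P, S P -> f.@[coords P] = 0.

(** The condition through which the global degree is compared with the local ones. *)
Definition contains_high_vanishing (k : fieldType) (I : set {mpoly k[3]}) : Prop :=
  exists M, forall n f, (M <= n)%N -> f \is n.-homog -> vanishes (zero_locus I) f -> I f.

Section PointCount.
Variables (k : closedFieldType) (I : set {mpoly k[3]}) (N : nat).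
Hypotheses (idI : ideal I) (grI : graded I).
Hypothesis hilbN : forall n, (N <= n)%N -> hilbert_fun I n = bour I.

(** Interpolation forms at the points are free modulo [I], since evaluation at a zero kills [I]. *)
Lemma points_le_bour r (Q : 'I_r -> P2 k) : injective Q ->
  (forall i, zero_locus I (Q i)) -> (r <= bour I)%N.
Proof.
move=> injQ QI; have [E hE] := choice (fun i => interpolation_form Q (Q i) (leq_maxr N r)).
apply: (free_mod_le_bour (u := E) idI hilbN (leq_maxl N r)) => [i|c Ic i]; first by case: (hE i).
have := QI i _ Ic; rewrite linear_sum /= (bigD1 i) //= big1 ?addr0 => [|j ne].
  by move/eqP; rewrite mevalZ mulf_eq0; case: (hE i) => _ /negbTE -> _; rewrite orbF => /eqP.
case: (hE j) => _ _ /(_ i) E0; rewrite mevalZ E0 ?mulr0 // => /injQ ij.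
by rewrite ij eqxx in ne.
Qed.

(** By [points_le_bour] there is a longest injective family of zeros, and it exhausts them. *)
Lemma zero_locus_enum : exists r (Q : 'I_r -> P2 k), injective Q /\ range Q = zero_locus I.
Proof.
pose T r := `[< exists Q : 'I_r -> P2 k, injective Q /\ forall i, zero_locus I (Q i) >].
have abs (i : 'I_0) : False by case: i.
have T0 : exists r, T r.
  by exists 0%N; apply/asboolP; exists (fun i => False_rect _ (abs i)); split=> [[]|[]].
have bT r : T r -> (r <= bour I)%N by move=> /asboolP[Q [injQ QI]]; apply: points_le_bour injQ QI.
have [r /asboolP[Q [injQ QI]] maxr] := ex_maxnP T0 bT.
exists r, Q; split=> //; apply/seteqP; split=> [_ [i _ <-]|P PI]; first exact: QI.
apply: contrapT => nP; suff /maxr : T r.+1 by rewrite ltnn.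
apply/asboolP; exists (fun i => oapp Q P (unlift ord0 i)); split=> [i j|i].
  have [i' ->|->] := unliftP ord0 i; have [j' ->|->] := unliftP ord0 j; rewrite ?liftK ?unlift_none //=.
  - by move/injQ => ->.
  - by move=> E; case: nP; exists i'.
  - by move=> E; case: nP; exists j'.
by case: (unlift ord0 i) => [j|]; [apply: QI | apply: PI].
Qed.

Lemma card_range_ord r (T : Type) (Q : 'I_r -> T) : injective Q -> (range Q #= `I_r)%card.
Proof.
move=> injQ; apply: card_eq_trans (_ : ([set: 'I_r] #= `I_r)%card).
  by apply: inj_card_eq => i j _ _; apply: injQ.
by rewrite card_eq_sym; apply: card_II.
Qed.

(** In large degree the interpolation forms are free modulo [I]. They form a basis exactly when
    every form is congruent to its interpolant, the difference of the two vanishing at all zeros. *)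
Lemma bour_eq_card r (Q : 'I_r -> P2 k) : injective Q -> range Q = zero_locus I ->
  bour I = r <-> contains_high_vanishing I.
Proof.
move=> injQ rQ; have QI i : zero_locus I (Q i) by rewrite -rQ; exists i.
have sDl (a1 a2 : k) (f : {mpoly k[3]}) : (a1 + a2) *: f = a1 *: f + a2 *: f by apply: scalerDl.
have IZ a f : I f -> I (a *: f) by move=> If; rewrite -mul_mpolyC; apply: idealM.
have evalE n (E : 'I_r -> {mpoly k[3]}) (c : 'I_r -> k) j :
    (forall i, [/\ E i \is n.-homog, (E i).@[coords (Q i)] != 0 &
      forall j, Q j <> Q i -> (E i).@[coords (Q j)] = 0]) ->
    (\sum_i c i *: E i).@[coords (Q j)] = c j * (E j).@[coords (Q j)].
  move=> hE; rewrite linear_sum /= (bigD1 j) //= big1 ?addr0 ?mevalZ // => i ne.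
  case: (hE i) => _ _ /(_ j) E0; rewrite mevalZ E0 ?mulr0 // => /injQ ij.
  by rewrite ij eqxx in ne.
split=> [bE|[M hM]].
  exists (maxn N r) => n f; rewrite geq_max => /andP[leN ler] hf fV.
  have [E hE] := choice (fun i => interpolation_form Q (Q i) ler).
  have [b hb] := hilbert_basis idI n.
  have {b hb} [b hb] : exists b : 'I_r -> _, quotient_basis
      (fun (c : k) f => c *: f) [set f : {mpoly k[3]} | f \is n.-homog] I b.
    by rewrite -bE -(hilbN leN); exists b.
  have fE c : I (\sum_i c i *: E i) -> forall i, c i = 0.
    move=> Ic i; have := QI i _ Ic; rewrite (evalE _ _ _ _ hE) => /eqP.
    by rewrite mulf_eq0; case: (hE i) => _ /negbTE -> _; rewrite orbF => /eqP.
  have [|_ _ /(_ f hf) [c Ic]] := quotient_basis_of_free sDl (@scalerDr _ _) (@scalerA _ _)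
    (@scale1r _ _) (ideal0 idI) (idealD idI) IZ hb _ fE.
    by move=> i; case: (hE i).
  move: (Ic); rewrite /lincomb big1 ?subr0 // => i _.
  have := QI i _ Ic; rewrite mevalB (fV _ (QI i)) sub0r (evalE _ _ _ _ hE) => /eqP.
  rewrite oppr_eq0 mulf_eq0; case: (hE i) => _ /negbTE -> _; rewrite orbF => /eqP ->.
  by rewrite scale0r.
pose n := maxn N (maxn M r); have leN : (N <= n)%N by rewrite leq_maxl.
have leM : (M <= n)%N by rewrite /n maxnCA leq_maxl.
have ler : (r <= n)%N by rewrite /n maxnA leq_maxr.
have [E hE] := choice (fun i => interpolation_form Q (Q i) ler).
rewrite -(hilbN leN); apply: (quotient_dimE sDl (@scalerDr _ _) (@scalerA _ _)
    (@scale1r _ _) (ideal0 idI) (idealD idI) IZ (b := E)); split=> [i|c Ic i|f hf].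
- by case: (hE i).
- have := QI i _ Ic; rewrite (evalE _ _ _ _ hE) => /eqP.
  by rewrite mulf_eq0; case: (hE i) => _ /negbTE -> _; rewrite orbF => /eqP.
- exists (fun i => f.@[coords (Q i)] / (E i).@[coords (Q i)]); apply: (hM n) => //.
    by apply: rpredB => //; apply: rpred_sum => i _; apply: rpredZ; case: (hE i).
  rewrite -rQ => _ [i _ <-]; rewrite mevalB (evalE _ _ _ _ hE) mulfVK ?subrr //.
  by case: (hE i).
Qed.

End PointCount.

(** * Local degrees *)

Section LocalAtPoint.
Variables (k : fieldType) (n : nat) (a : 'I_n -> k).
Notation A := {mpoly k[n]}.
Local Notation F := (@tofrac A).

Definition gen_point_ideal : set A := ideal_gen [seq 'X_j - (a j)%:MP | j <- enum 'I_n].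

Lemma gen_point_idealE g : gen_point_ideal g <-> g.@[a] = 0.
Proof.
split=> [|ga].
  suff /ideal_gen_min : ideal [set h : A | h.@[a] = 0].
    by apply=> _ /mapP[j _ ->]; rewrite /= mevalB mevalXU mevalC subrr.
  split=> [|b c|b c] /=; first by rewrite meval0.
    by rewrite mevalD => -> ->; rewrite addr0.
  by rewrite mevalM => ->; rewrite mulr0.
have := @comp_mpoly_congr _ _ _ _ (ideal_gen_ideal _) [tuple 'X_j | j < n]
  [tuple (a j)%:MP | j < n] g.
rewrite comp_mpoly_id comp_const ga mpolyC0 subr0; apply=> j; rewrite !tnth_mktuple.
by apply: mem_ideal_gen; apply: map_f; rewrite mem_enum.
Qed.

Variable J : set A.
Hypothesis idJ : ideal J.
Hypothesis J_vanish : forall f, J f -> f.@[a] = 0.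

Let m := gen_point_ideal.
Let notm s : (~ m s) <-> s.@[a] != 0.
Proof.
rewrite /m gen_point_idealE; split=> [h|/eqP//].
exact/eqP.
Qed.

Let F_neq0 s : s.@[a] != 0 -> F s != 0.
Proof. by apply: contra_neq => /eqP; rewrite tofrac_eq0 => /eqP ->; rewrite meval0. Qed.

(** Two representations of a fraction are compared by cross-multiplication; [t] is the denominator
    of the one with numerator in [J]. *)
Lemma localize_frac f s : s.@[a] != 0 ->
  localize m J (F f / F s) <-> exists t, t.@[a] != 0 /\ J (t * f).
Proof.
move=> sa; split=> [[f' [s' [Jf' /notm s'a E]]]|[t [ta Jtf]]].
  move/eqP: E; rewrite eqr_div ?F_neq0 // -!tofracM tofrac_eq => /eqP E.
  by exists s'; split=> //; rewrite mulrC E; apply: (ideal_mulr idJ).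
exists (t * f), (t * s); split=> //; first by apply/notm; rewrite mevalM mulf_neq0.
by rewrite !tofracM -mulf_div divff ?mul1r // F_neq0.
Qed.

Let scale (c : k) (x : {fraction A}) := F c%:MP * x.
Let sDl b c x : scale (b + c) x = scale b x + scale c x.
Proof. by rewrite /scale mpolyCD tofracD mulrDl. Qed.
Let sDr c x y : scale c (x + y) = scale c x + scale c y. Proof. exact: mulrDr. Qed.
Let sA b c x : scale b (scale c x) = scale (b * c) x.
Proof. by rewrite /scale mpolyCM tofracM mulrA. Qed.
Let s1 x : scale 1 x = x. Proof. by rewrite /scale mpolyC1 tofrac1 mul1r. Qed.

Lemma localizeD x y : localize m J x -> localize m J y -> localize m J (x + y).
Proof.
move=> [f [s [Jf /notm sa ->]]] [g [t [Jg /notm ta ->]]].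
exists (f * t + g * s), (s * t); split.
- by apply: (idealD idJ); apply: (ideal_mulr idJ).
- by apply/notm; rewrite mevalM mulf_neq0.
- by rewrite addf_div ?F_neq0 // tofracD !tofracM.
Qed.

Lemma localizeZ c x : localize m J x -> localize m J (scale c x).
Proof.
move=> [f [s [Jf ms ->]]]; exists (c%:MP * f), s; split=> //; first exact: (idealM idJ).
by rewrite /scale tofracM mulrA.
Qed.

Lemma localize0 : localize m J 0.
Proof.
exists 0, 1; split; first exact: ideal0.
  by apply/notm; rewrite meval1 oner_neq0.
by rewrite tofrac0 mul0r.
Qed.

(** As [J] vanishes at [a], this says that it generates the maximal ideal of the local ring; [s] is
    a cleared denominator. *)
Definition generates_max_locally : Prop :=
  forall h : A, h.@[a] = 0 -> exists s, s.@[a] != 0 /\ J (s * h).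

Lemma local_dim1P : quotient_dim scale (localize m setT) (localize m J) = 1%N <->
  generates_max_locally.
Proof.
have frac_in f s : s.@[a] != 0 -> localize m setT (F f / F s).
  by move=> sa; exists f, s; split=> //; apply/notm.
have combE h s c f0 s0 : s.@[a] != 0 -> s0.@[a] != 0 ->
    F h / F s - scale c (F f0 / F s0) = F (h * s0 - c%:MP * f0 * s) / F (s * s0).
  move=> sa s0a; rewrite /scale mulrA -tofracM -mulNr -tofracN addf_div ?F_neq0 //.
  by rewrite -!tofracM -tofracD mulNr.
split=> [dim1 h ha|gen].
  have [b [Vb _ sb]] : exists b : 'I_1 -> {fraction A},
      quotient_basis scale (localize m setT) (localize m J) b.
    by move: dim1; rewrite /quotient_dim; case: xgetP => [r _ hr E|_ //]; move: hr; rewrite E.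
  have [f0 [s0 [_ /notm s0a Eb]]] := Vb ord0.
  (* Modulo the extension of [J], every polynomial is a scalar times the basis element [f0 / s0]. *)
  have key g : exists c t, t.@[a] != 0 /\ J (t * (g * s0 - c%:MP * f0)).
    have oa : (1 : A).@[a] != 0 by rewrite meval1 oner_neq0.
    have [c] := sb _ (frac_in g 1 oa); rewrite big_ord1 Eb combE // mulr1 mul1r.
    by case/(localize_frac _ s0a) => t Jt; exists (c ord0), t.
  (* Applied to the polynomial 1, this shows that the basis element is a unit; hence the scalar
     attached to [h], which vanishes at [a], is 0. *)
  have f0a : f0.@[a] != 0.
    have [c [t [ta /J_vanish]]] := key 1; rewrite mul1r mevalM mevalB mevalM => /eqP.
    rewrite mulf_eq0 (negbTE ta) /= subr_eq0 => /eqP E.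
    by apply: contra_neq s0a => f0a; rewrite E f0a mulr0.
  have [c [t [ta Jt]]] := key h.
  have c0 : c = 0.
    move/J_vanish: (Jt) => /eqP; rewrite !(mevalM, mevalB, mevalC) ha mul0r sub0r.
    by rewrite mulf_eq0 (negbTE ta) oppr_eq0 mulf_eq0 (negbTE f0a) orbF => /eqP.
  exists (t * s0); split; first by rewrite mevalM mulf_neq0.
  by move: Jt; rewrite c0 mpolyC0 mul0r subr0 -mulrA [s0 * h]mulrC.
(* Conversely the class of 1 is a basis, the coordinate of a fraction being its value at [a]. *)
apply: (quotient_dimE sDl sDr sA s1 localize0 localizeD localizeZ (b := fun _ : 'I_1 => 1)).
have oa : (1 : A).@[a] != 0 by rewrite meval1 oner_neq0.
split=> [_|c|v [f [s [_ /notm sa ->]]]].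
- by rewrite -[1](divr1 1) -tofrac1; apply: frac_in.
- rewrite big_ord1 => W1 i; rewrite ord1; move: W1.
  rewrite /scale mulr1 -[F _]divr1 -tofrac1 => /(localize_frac _ oa)[t [ta /J_vanish/eqP]].
  by rewrite mevalM mevalC mulf_eq0 (negbTE ta) => /eqP.
- exists (fun=> f.@[a] / s.@[a]); rewrite big_ord1 -[X in scale _ X](divr1 1) -tofrac1 combE //.
  rewrite !mulr1; apply/(localize_frac _ sa); apply: gen.
  by rewrite mevalB mevalM mevalC mulfVK // subrr.
Qed.

End LocalAtPoint.

(** * Dehomogenization and homogenization *)

Section Dehomogenize.
Variables (k : closedFieldType) (i : 'I_3).

HB.instance Definition _ := GRing.RMorphism.copy (@dehom k i) (comp_mpoly _).

Lemma dehomXU j :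
  dehom i ('X_j : {mpoly k[3]}) = if unlift i j is Some j' then 'X_j' else 1.
Proof. by rewrite /dehom comp_mpolyXU -tnth_nth tnth_mktuple. Qed.

Lemma dehomC c : dehom i (c%:MP : {mpoly k[3]}) = c%:MP.
Proof. exact: comp_mpolyC. Qed.

Lemma dehom_meval (f : {mpoly k[3]}) (p : 'I_3 -> k) : p i = 1 ->
  (dehom i f).@[fun j => p (lift i j)] = f.@[p].
Proof.
move=> pi1; rewrite /dehom comp_mpoly_meval; apply: meval_eq => j; rewrite tnth_mktuple.
by case: unliftP => [j'|] ->; rewrite ?mevalXU ?meval1.
Qed.

Definition rename_vars (g : {mpoly k[2]}) : {mpoly k[3]} := g \mPo [tuple 'X_(lift i j) | j < 2].

HB.instance Definition _ := GRing.RMorphism.copy rename_vars (comp_mpoly _).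

Lemma rename_varsK : cancel rename_vars (dehom i).
Proof.
apply: (mpoly_rmorph_ext (f := (@dehom k i) \o rename_vars) (g := idfun)) => [c|j] /=.
  by rewrite /rename_vars comp_mpolyC dehomC.
by rewrite /rename_vars comp_mpolyXU -tnth_nth tnth_mktuple dehomXU liftK.
Qed.

(** Each component of [g] is padded with a power of ['X_i]. Any degree bound [n] is allowed, so that
    degrees can be matched later. *)
Lemma homogenization (g : {mpoly k[2]}) n : (msize g <= n.+1)%N ->
  exists2 f : {mpoly k[3]}, f \is n.-homog & dehom i f = g.
Proof.
move=> le; exists (\sum_(d < n.+1) rename_vars (pihomog mdeg d g) * 'X_i ^+ (n - d)).
  apply: rpred_sum => d _.
  have hr : rename_vars (pihomog mdeg d g) \is d.-homog.
    by apply: comp_homog (pihomogP _ _ _) => j; rewrite tnth_mktuple; apply: homogXU.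
  apply: (homogM_eq hr (dhomogMn (n - d) (homogXU _ i))).
  by rewrite mul1n subnKC // -ltnS.
rewrite rmorph_sum [RHS](pihomog_partitionE le); apply: eq_bigr => d _.
by rewrite rmorphM rmorphXn /= dehomXU unlift_none expr1n mulr1 rename_varsK.
Qed.

(** A nonzero form has a nonzero value at some point with nonzero [i]-th coordinate; scaling that
    coordinate to 1 gives a nonzero value of its dehomogenization. *)
Lemma dehom_inj n (f g : {mpoly k[3]}) : f \is n.-homog -> g \is n.-homog ->
  dehom i f = dehom i g -> f = g.
Proof.
move=> hf hg E; apply: subr0_eq; apply: contrapT => /eqP fg0.
have [v] : exists v, ((f - g) * 'X_i).@[v] != 0.
  by apply: mpoly_nonzero_point; rewrite mulf_neq0 // -msize_poly_eq0 msizeX.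
rewrite mevalM mevalXU mulf_eq0 negb_or => /andP[/negP fgv vi]; apply: fgv.
pose w j := v j / v i; have hfg : f - g \is n.-homog by apply: rpredB.
rewrite (_ : (f - g).@[v] = v i ^+ n * (f - g).@[w]); last first.
  by rewrite -(meval_scale _ _ hfg); apply: meval_eq => j; rewrite /w mulrCA divff ?mulr1.
have wi : w i = 1 by rewrite /w divff.
by rewrite -(dehom_meval (f - g) wi) rmorphB /= E subrr meval0 mulr0.
Qed.

Variable I : set {mpoly k[3]}.
Hypotheses (idI : ideal I) (grI : graded I).

Lemma dehom_ideal : ideal (dehom i @` I).
Proof.
split=> [|_ _ [f If <-] [g Ig <-]|c _ [f If <-]].
- by exists 0; [apply: ideal0 | rewrite rmorph0].
- by exists (f + g); [apply: idealD | rewrite rmorphD].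
- by exists (rename_vars c * f); [apply: idealM | rewrite rmorphM /= rename_varsK].
Qed.

Lemma dehom_homog_lift (g : {mpoly k[3]}) n : I g -> (msize g <= n.+1)%N ->
  exists f, [/\ I f, f \is n.-homog & dehom i f = dehom i g].
Proof.
move=> Ig le; exists (\sum_(d < n.+1) pihomog mdeg d g * 'X_i ^+ (n - d)); split.
- by apply: (ideal_sum idI) => d _; apply: ideal_mulr => //; apply: grI.
- apply: rpred_sum => d _.
  apply: (homogM_eq (pihomogP _ _ _) (dhomogMn (n - d) (homogXU _ i))).
  by rewrite mul1n subnKC // -ltnS.
rewrite rmorph_sum {2}(pihomog_partitionE le) rmorph_sum; apply: eq_bigr => d _.
by rewrite rmorphM rmorphXn /= dehomXU unlift_none expr1n mulr1.
Qed.

End Dehomogenize.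

(** * Local degree one at a projective point *)

Section LocalBour.
Variables (k : closedFieldType) (I : set {mpoly k[3]}).
Hypotheses (idI : ideal I) (grI : graded I).

Definition affine_coords (P : P2 k) (j : 'I_2) : k := coords P (lift (chart P) j).

Lemma dehom_coords P (f : {mpoly k[3]}) :
  (dehom (chart P) f).@[affine_coords P] = f.@[coords P].
Proof. by apply: dehom_meval; have [] := chartP P. Qed.

Definition locally_reduced P :=
  generates_max_locally (affine_coords P) (dehom (chart P) @` I).

Lemma local_bour1P P : zero_locus I P -> local_bour I P = 1%N <-> locally_reduced P.
Proof.
move=> PI; apply: local_dim1P; first exact: dehom_ideal.
by move=> _ [f If <-]; rewrite dehom_coords; apply: PI.
Qed.

(** Both sides of the affine relation are lifted to forms of degree [m + n], which coincide because
    their dehomogenizations do. *)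
Lemma locally_reduced_lift P n (f : {mpoly k[3]}) : locally_reduced P ->
  f \is n.-homog -> f.@[coords P] = 0 ->
  exists s m, [/\ s \is m.-homog, s.@[coords P] != 0 & I (s * f)].
Proof.
move=> red hf fP; have [|t [tP [g Ig Eg]]] := red (dehom (chart P) f).
  by rewrite dehom_coords.
pose m := maxn (msize t) (msize g).
have [|s hs Es] := @homogenization k (chart P) t m; first by rewrite leqW ?leq_maxl.
have [|g' [Ig' hg' Eg']] := dehom_homog_lift (chart P) idI grI (n := m + n) Ig.
  by rewrite leqW // (leq_trans (leq_maxr (msize t) (msize g))) ?leq_addr.
exists s, m; split=> //; first by rewrite -dehom_coords Es.
suff -> : s * f = g' by [].
apply: (dehom_inj (i := chart P) (dhomogM hs hf) hg').
by rewrite rmorphM /= Es Eg' Eg.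
Qed.

(** An interpolation form [E], nonzero at [P] and zero at the other zeros, makes [E * f] vanish on
    the whole zero locus, and it is a unit locally at [P]. *)
Lemma locally_reduced_of_sub M P r (Q : 'I_r -> P2 k) : range Q = zero_locus I ->
  (forall n f, (M <= n)%N -> f \is n.-homog -> vanishes (zero_locus I) f -> I f) ->
  locally_reduced P.
Proof.
move=> rQ sub h hP; pose m := maxn M (msize h).
have [|f hf Ef] := @homogenization k (chart P) h m; first by rewrite leqW ?leq_maxr.
have [E [hE EP EQ]] := interpolation_form Q P (leqnn r).
exists (dehom (chart P) E); split; first by rewrite dehom_coords.
exists (E * f); last by rewrite rmorphM /= Ef.
apply: (sub (r + m)%N); first by rewrite (leq_trans (leq_maxl M (msize h))) ?leq_addl.
  exact: dhomogM.
rewrite -rQ => _ [j _ <-]; rewrite mevalM; have [QP|/EQ ->] := pselect (Q j = P).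
  by rewrite QP -[f.@[_]]dehom_coords Ef hP mulr0.
by rewrite mul0r.
Qed.

End LocalBour.

Section ReducedScheme.
Variables (k : closedFieldType) (gs : seq {mpoly k[3]}).
Let I := ideal_gen gs.
Hypotheses (hgs : homogeneous_gens gs) (ncf : no_common_factor gs).

Let idI : ideal I := ideal_gen_ideal gs.
Let grI : graded I := ideal_gen_graded hgs.

Lemma bour_reduced : exists r (Q : 'I_r -> P2 k),
  [/\ injective Q, range Q = zero_locus I, (r <= bour I)%N,
      bour I = r <-> contains_high_vanishing I &
      contains_high_vanishing I <-> forall P, zero_locus I P -> local_bour I P = 1%N].
Proof.
have [l [N [hl surj]]] := good_line hgs ncf.
have [N' [leN hilb]] := hilbert_stable idI grI hl surj.
have cancel := eventually_cancel_line idI grI hl surj leN hilb.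
have [r [Q [injQ rQ]]] := zero_locus_enum idI hilb.
exists r, Q; split=> //.
- by apply: (points_le_bour idI hilb injQ) => i; rewrite -rQ; exists i.
- exact: (bour_eq_card idI hilb injQ rQ).
split=> [[M hM] P PI|red].
  by apply/(local_bour1P idI PI); apply: locally_reduced_of_sub rQ hM.
exists N'.
have JM : forall c f, vanishes (zero_locus I) f -> vanishes (zero_locus I) (c * f).
  by move=> c f fV P PI; rewrite mevalM fV // mulr0.
(* The eigenvalues [p] form a nonzero vector; once scaled it is a point of the zero locus, where the
   local degree is 1. *)
apply: (homog_sub_of_local idI grI hl hilb cancel JM) => p p0 pI n f hf fV.
have [P [t [t0 E]]] := P2_normalize p0.
have PI : zero_locus I P.
  move=> g Ig; rewrite (pihomog_partitionE (leqnn (msize g))) linear_sum big1 //= => d _.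
  have /eqP := pI _ (grI d Ig); rewrite (meval_coords (pihomogP _ _ _) E) mulf_eq0.
  by rewrite expf_eq0 (negbTE t0) andbF => /eqP.
have /(local_bour1P idI PI) rP := red P PI.
have [s [m [hs sP Is]]] := locally_reduced_lift idI grI rP hf (fV P PI).
exists s, m; split=> //.
by rewrite (meval_coords hs E) mulf_neq0 // expf_neq0.
Qed.

End ReducedScheme.

(** * Ideals of points generated by two lines *)

(** Elimination of [z] between two linear forms leaves two entries of the cross product as
    coefficients; rotating the variables gives the other cases. *)
Lemma cross_product_identity (A : comNzRingType) (a b c a' b' c' x y z : A) :
  (b * c' - c * b') * y - (c * a' - a * c') * x =
  c' * (a * x + b * y + c * z) + (- c) * (a' * x + b' * y + c' * z).
Proof. ring. Qed.

Lemma cross_product_orthogonal (A : comNzRingType) (a b c a' b' c' : A) :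
  a * (b * c' - c * b') + b * (c * a' - a * c') + c * (a * b' - b * a') = 0 /\
  a' * (b * c' - c * b') + b' * (c * a' - a * c') + c' * (a * b' - b * a') = 0.
Proof. by split; ring. Qed.

Definition cross_product (A : comNzRingType) (a b : 'I_3 -> A) (i : 'I_3) : A :=
  let o1 := lift ord0 ord0 in
  match val i with
  | 0%N => a o1 * b ord_max - a ord_max * b o1
  | 1%N => a ord_max * b ord0 - a ord0 * b ord_max
  | _ => a ord0 * b o1 - a o1 * b ord0 end.

Section LinearPoint.
Variable k : closedFieldType.

(** Modulo [K], [p i *: 'X_j] equals [p j *: 'X_i], so [p i ^+ n *: f] is congruent to [f.@[p] *:
    'X_i ^+ n], which is 0. *)
Lemma form_in_ideal_of_point (K : set {mpoly k[3]}) (p : 'I_3 -> k) i n f :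
  ideal K -> p i != 0 -> (forall j, K (p i *: 'X_j - p j *: 'X_i)) ->
  f \is n.-homog -> f.@[p] = 0 -> K f.
Proof.
move=> idK pi0 Kp hf fp.
have := @comp_mpoly_congr _ _ _ _ idK [tuple (p i)%:MP * 'X_j | j < 3]
  [tuple 'X_i * (p j)%:MP | j < 3] f.
rewrite (comp_homog_scale (fun j => 'X_j) _ hf) comp_mpoly_id (comp_homog_point _ _ hf) fp.
rewrite mpolyC0 mulr0 subr0 -rmorphXn /=.
have H j : K (tnth [tuple (p i)%:MP * 'X_j | j < 3] j - tnth [tuple 'X_i * (p j)%:MP | j < 3] j).
  by rewrite !tnth_mktuple [X in _ - X]mulrC !mul_mpolyC.
move=> /(_ H) /(idealM idK ((p i ^+ n)^-1)%:MP).
by rewrite mulrA -mpolyCM mulVf ?expf_neq0 // mul1r.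
Qed.

Lemma msize_linear (l : {mpoly k[3]}) : l \is 1.-homog -> l != 0 -> msize l = 2%N.
Proof.
by move=> hl l0; rewrite -mlead_deg // (dhomog_mf hl) // mlead_supp.
Qed.

Lemma meval_linear (l : {mpoly k[3]}) (p : 'I_3 -> k) : l \is 1.-homog ->
  l.@[p] = \sum_i l@_U_(i) * p i.
Proof.
move=> hl; rewrite {1}(linear_form_sum hl) linear_sum /=; apply: eq_bigr => i _.
by rewrite mevalZ mevalXU.
Qed.

Lemma sum3 (V : nmodType) (G : 'I_3 -> V) :
  \sum_i G i = G ord0 + G (lift ord0 ord0) + G ord_max.
Proof.
rewrite !big_ord_recl big_ord0 addr0 addrA; congr (_ + _ + G _).
exact: val_inj.
Qed.

Lemma ord3_ind (P : 'I_3 -> Prop) :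
  P ord0 -> P (lift ord0 ord0) -> P ord_max -> forall i, P i.
Proof.
move=> P0 P1 P2 [[|[|[|//]]] h].
- by rewrite (_ : Ordinal h = ord0) //; apply: val_inj.
- by rewrite (_ : Ordinal h = lift ord0 ord0) //; apply: val_inj.
- by rewrite (_ : Ordinal h = ord_max) //; apply: val_inj.
Qed.

(* The common zero of two lines is the cross product p of their coefficient
   vectors, and p_i X_j - p_j X_i lies in the ideal they generate. *)
Lemma two_lines_point (I : set {mpoly k[3]}) (L1 L2 : {mpoly k[3]}) :
  L1 \is 1.-homog -> L2 \is 1.-homog ->
  (forall f, I f <-> exists a b, f = a * L1 + b * L2) ->
  (forall h : {mpoly k[3]}, (forall f, I f -> exists q, f = q * h) -> (msize h <= 1)%N) ->
  exists P, zero_locus I = [set P] /\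
    forall n f, f \is n.-homog -> f.@[coords P] = 0 -> I f.
Proof.
move=> h1 h2 IE ncf.
have idI : ideal I.
  split=> [|f g /IE[a [b ->]] /IE[a' [b' ->]]|c f /IE[a [b ->]]]; apply/IE.
  - by exists 0, 0; rewrite !mul0r addr0.
  - by exists (a + a'), (b + b'); rewrite !mulrDl addrACA.
  - by exists (c * a), (c * b); rewrite mulrDr !mulrA.
set o1 : 'I_3 := lift ord0 ord0.
have [a Ea] : exists a : 'I_3 -> k, forall i, L1@_U_(i) = a i by eexists.
have [b Eb] : exists b : 'I_3 -> k, forall i, L2@_U_(i) = b i by eexists.
have [p Ep'] : exists p, p = cross_product a b by eexists.
have p0E : p ord0 = a o1 * b ord_max - a ord_max * b o1 by rewrite Ep'.
have p1E : p o1 = a ord_max * b ord0 - a ord0 * b ord_max by rewrite Ep'.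
have p2E : p ord_max = a ord0 * b o1 - a o1 * b ord0 by rewrite Ep'.
have E1 : L1 = (a ord0)%:MP * 'X_ord0 + (a o1)%:MP * 'X_o1 + (a ord_max)%:MP * 'X_ord_max.
  by rewrite {1}(linear_form_sum h1) sum3 !Ea !mul_mpolyC.
have E2 : L2 = (b ord0)%:MP * 'X_ord0 + (b o1)%:MP * 'X_o1 + (b ord_max)%:MP * 'X_ord_max.
  by rewrite {1}(linear_form_sum h2) sum3 !Eb !mul_mpolyC.
clear Ep'.
have c01 : I (p ord0 *: 'X_o1 - p o1 *: 'X_ord0).
  apply/IE; exists (b ord_max)%:MP, (- (a ord_max)%:MP).
  rewrite -!mul_mpolyC p0E p1E !mpolyCB !mpolyCM E1 E2; exact: cross_product_identity.
have c12 : I (p o1 *: 'X_ord_max - p ord_max *: 'X_o1).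
  apply/IE; exists (b ord0)%:MP, (- (a ord0)%:MP).
  rewrite -!mul_mpolyC p1E p2E !mpolyCB !mpolyCM E1 E2 -!addrA.
  rewrite ![_%:MP * 'X_ord0 + _]addrC; exact: cross_product_identity.
have c20 : I (p ord_max *: 'X_ord0 - p ord0 *: 'X_ord_max).
  apply/IE; exists (b o1)%:MP, (- (a o1)%:MP).
  rewrite -!mul_mpolyC p2E p0E !mpolyCB !mpolyCM E1 E2.
  rewrite ![_ + _%:MP * 'X_ord_max]addrC !addrA; exact: cross_product_identity.
have flip x y : I (x - y) -> I (y - x) by move/(idealN idI); rewrite opprB.
have diag x : I (x - x) by rewrite subrr; apply: ideal0.
have cross i j : I (p i *: 'X_j - p j *: 'X_i).
  move: j; apply: ord3_ind; move: i; apply: ord3_ind;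
    by [apply: diag | apply: c01 | apply: c12 | apply: c20 |
        apply: flip; apply: c01 | apply: flip; apply: c12 | apply: flip; apply: c20].
(* If the cross product vanished, the lines would be proportional and share a factor of degree 1: a
   nonzero one of them, or a variable if both are 0. *)
have nzp : exists i, p i != 0.
  apply: contrapT => /forallNP p0.
  have {}p0 i : p i = 0 by apply/eqP/negPn/negP/p0.
  have := p0 ord0; have := p0 o1; have := p0 ord_max; rewrite p0E p1E p2E.
  move=> /subr0_eq q2 /subr0_eq q1 /subr0_eq q0.
  have prop m j : a j * b m = a m * b j.
    by move: j; apply: ord3_ind; move: m; apply: ord3_ind.
  have prop' m : b m *: L1 = a m *: L2.
    rewrite (linear_form_sum h1) (linear_form_sum h2) !scaler_sumr; apply: eq_bigr => j _.
    by rewrite !scalerA Ea Eb mulrC prop.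
  have [h [hh h0 [q1' Eq1] [q2' Eq2]]] : exists h : {mpoly k[3]},
      [/\ h \is 1.-homog, h != 0, exists q, L1 = q * h & exists q, L2 = q * h].
    have [L20|L20] := eqVneq L2 0; last first.
      exists L2; split=> //; last by exists 1; rewrite mul1r.
      have [m bm] : exists m, b m != 0.
        apply: contrapT => /forallNP b0; case/eqP: L20; rewrite (linear_form_sum h2) big1 // => j _.
        by have /negP/negPn/eqP := b0 j; rewrite Eb => ->; rewrite scale0r.
      exists ((b m)^-1 * a m)%:MP; rewrite mpolyCM -mulrA !mul_mpolyC -prop'.
      by rewrite scalerA mulVf // scale1r.
    have [L10|L10] := eqVneq L1 0.
      exists 'X_ord0; split; [exact: homogXU| by rewrite -msize_poly_eq0 msizeX | |].
        by exists 0; rewrite mul0r.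
      by exists 0; rewrite mul0r.
    by exists L1; split=> //; [exists 1; rewrite mul1r | exists 0; rewrite mul0r].
  have : (msize h <= 1)%N.
    apply: ncf => f /IE[c [d ->]]; exists (c * q1' + d * q2').
    by rewrite {1}Eq1 {1}Eq2 mulrDl !mulrA.
  by rewrite msize_linear.
have [P [t [t0 Ep]]] := P2_normalize nzp.
have [i pi0] := nzp.
exists P; split; last first.
  move=> n f hf fP; apply: (form_in_ideal_of_point idI pi0 (cross i) hf).
  by rewrite (meval_coords hf Ep) fP mulr0.
apply/seteqP; split=> [Q QI|_ -> f /IE[c [d ->]]].
  apply: P2_proportional => m j.
  have := QI _ (cross m j); rewrite mevalB !mevalZ !mevalXU !Ep => /subr0_eq.
  rewrite -!mulrA => /(mulfI t0) E.
  by rewrite [LHS]mulrC -E mulrC.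
have key L : L \is [in k[3], 1.-homog] -> L.@[p] = 0 -> L.@[coords P] = 0.
  move=> hL /eqP; rewrite (meval_coords hL Ep) mulf_eq0 expr1 (negbTE t0) /=.
  by move/eqP.
have [z1 z2] := cross_product_orthogonal (a ord0) (a o1) (a ord_max) (b ord0) (b o1) (b ord_max).
have Lp1 : L1.@[p] = 0 by rewrite (meval_linear _ h1) sum3 !Ea p0E p1E p2E z1.
have Lp2 : L2.@[p] = 0 by rewrite (meval_linear _ h2) sum3 !Eb p0E p1E p2E z2.
by rewrite mevalD !mevalM (key _ h1 Lp1) (key _ h2 Lp2) !mulr0 addr0.
Qed.

End LinearPoint.

(** * Syzygies and nearly free curves *)

(** Two consecutive maps of the Koszul complex compose to 0. *)
Lemma koszul_relation (A : comNzRingType) (V : lmodType A) (x y z : A) (u v w : V) :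
  z *: (y *: u - x *: v) - y *: (z *: u - x *: w) + x *: (z *: v - y *: w) = 0.
Proof.
rewrite !scalerBr !scalerA opprB [z * y]mulrC [z * x]mulrC [y * x]mulrC.
by rewrite addrAC !subrKA subrr.
Qed.

Section Koszul.
Variables (k : fieldType) (n : nat).

Lemma ndiv_var (i j : 'I_n) : i != j -> ~ exists r : {mpoly k[n]}, 'X_i = r * 'X_j.
Proof.
move=> ij [r /(congr1 (meval (fun m => (m == i)%:R)))].
rewrite mevalM !mevalXU eqxx eq_sym (negbTE ij) mulr0 => /eqP.
by rewrite oner_eq0.
Qed.

Lemma var_neq0 (i : 'I_n) : 'X_i != 0 :> {mpoly k[n]}.
Proof. by rewrite -msize_poly_eq0 msizeX. Qed.

Lemma koszul_exact (x y z : 'I_n) (a b c : {mpoly k[n]}) : x != y -> x != z -> y != z ->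
  'X_z * a - 'X_y * b + 'X_x * c = 0 ->
  exists p q r, a = 'X_y * p + 'X_x * q /\ b = 'X_z * p + 'X_x * r.
Proof.
move=> xy xz yz E.
pose u : n.-tuple {mpoly k[n]} := [tuple (if j == x then 0 else 'X_j) | j < n].
have Xu j : 'X_j \mPo u = (if j == x then 0 else 'X_j).
  by rewrite comp_mpolyXU -tnth_nth tnth_mktuple.
have ret f : exists q, f - (f \mPo u) = 'X_x * q.
  have idK : ideal [set h : {mpoly k[n]} | exists q, h = 'X_x * q].
    split=> [|h g [q ->] [r ->]|h g [q ->]] /=; first by exists 0; rewrite mulr0.
      by exists (q + r); rewrite mulrDr.
    by exists (h * q); rewrite mulrCA.
  have := @comp_mpoly_congr _ _ _ _ idK [tuple 'X_j | j < n] u f.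
  rewrite comp_mpoly_id; apply=> j; rewrite !tnth_mktuple; case: eqP => [->|_].
    by exists 1; rewrite subr0 mulr1.
  by exists 0; rewrite subrr mulr0.
have [qa Ea] := ret a; have [qb Eb] := ret b.
have := congr1 (comp_mpoly u) E; rewrite !(rmorphB, rmorphD, rmorphM) /= !Xu eqxx mul0r addr0.
rewrite comp_mpoly0 ![_ == x]eq_sym (negbTE xy) (negbTE xz) => /subr0_eq E0.
have [|[p Ep]|/ndiv_var] := linear_form_prime (p := a \mPo u) (q := 'X_z) (var_neq0 y) (homogXU k y).
- by exists (b \mPo u); rewrite mulrC E0 mulrC.
- exists p, qa, qb; split; first by rewrite -Ea mulrC -Ep addrC subrK.
  rewrite -Eb; suff -> : 'X_z * p = b \mPo u by rewrite addrC subrK.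
  by apply: (mulfI (var_neq0 y)); rewrite -E0 Ep mulrCA [p * _]mulrC.
- by rewrite eq_sym yz => /(_ isT).
Qed.
End Koszul.

Section Syzygies.
Variables (k : closedFieldType) (F : {mpoly k[3]}).
Notation R := {mpoly k[3]}.
Implicit Types u v w : 'rV[R]_3.

Lemma Syz0 : Syz F 0.
Proof. by rewrite /Syz /= big1 // => i _; rewrite mxE mul0r. Qed.

Lemma SyzD u v : Syz F u -> Syz F v -> Syz F (u + v).
Proof.
rewrite /Syz /= => Eu Ev; under eq_bigr do rewrite mxE mulrDl.
by rewrite big_split /= Eu Ev addr0.
Qed.

Lemma SyzZ (c : R) u : Syz F u -> Syz F (c *: u).
Proof.
rewrite /Syz /= => Eu; under eq_bigr do rewrite mxE -mulrA.
by rewrite -mulr_sumr Eu mulr0.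
Qed.

Lemma SyzN u : Syz F u -> Syz F (- u).
Proof. by rewrite -scaleN1r; apply: SyzZ. Qed.

Lemma Syz_sum n (c : 'I_n -> R) (g : 'I_n -> 'rV[R]_3) (P : pred 'I_n) :
  (forall i, Syz F (g i)) -> Syz F (\sum_(i | P i) c i *: g i).
Proof. by move=> Sg; elim/big_ind: _ => [|u v|i _]; [apply: Syz0|apply: SyzD|apply: SyzZ]. Qed.

Lemma Syz_cancel (c : R) u : c != 0 -> Syz F (c *: u) -> Syz F u.
Proof.
move=> c0; rewrite /Syz /= => E; apply: (mulfI c0); rewrite mulr0 -[RHS]E mulr_sumr.
by apply: eq_bigr => i _; rewrite mxE mulrA.
Qed.

Definition vec_part d v : 'rV[R]_3 := map_mx (pihomog mdeg d) v.

Lemma vec_part_homog d v : vec_homog d (vec_part d v).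
Proof. by move=> i; rewrite mxE; apply: pihomogP. Qed.

Lemma vec_part_id d v : vec_homog d v -> vec_part d v = v.
Proof. by move=> hv; apply/rowP => i; rewrite mxE pihomog_dE. Qed.

Lemma vec_part_sum v : exists b, v = \sum_(d < b) vec_part d v.
Proof.
pose s i := msize (v 0 i); exists (\max_i s i)%N; apply/rowP => i.
rewrite summxE (eq_bigr (fun d : 'I__ => pihomog mdeg d (v 0 i))) => [|j _]; last by rewrite mxE.
by apply: pihomog_partitionE; apply: (leq_bigmax (F := s)).
Qed.

Lemma vec_part_sumr d n (w : 'I_n -> 'rV[R]_3) :
  vec_part d (\sum_i w i) = \sum_i vec_part d (w i).
Proof.
apply/rowP => j; rewrite mxE !summxE linear_sum; apply: eq_bigr => i _.
by rewrite mxE.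
Qed.

Lemma vec_partZ d e (c : R) v : vec_homog e v ->
  vec_part d (c *: v) = if (e <= d)%N then pihomog mdeg (d - e) c *: v else 0.
Proof.
move=> hv; apply/rowP => i; rewrite !mxE (pihomogM _ _ (hv i)).
by case: ifP; rewrite mxE.
Qed.

Lemma mderiv_homog d i : F \is d.+1.-homog -> F^`M(i) \is d.-homog.
Proof.
move=> hF; apply/dhomogP => m; rewrite mcoeff_msupp mcoeff_deriv => nz.
have : (m + U_(i))%MM \in msupp F.
  by rewrite mcoeff_msupp; apply: contra_neq nz => ->; rewrite mul0rn.
by move/(dhomog_mf hF); rewrite /= mdegD mdeg1 addn1 => -[].
Qed.

(** All partial derivatives of [F] have degree [d], so the component of degree [n + d] of the
    relation involves exactly the part of degree [n] of [v]. *)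
Lemma Syz_part d n v : F \is d.+1.-homog -> Syz F v -> Syz F (vec_part n v).
Proof.
move=> hF; rewrite /Syz /= => /(congr1 (pihomog mdeg (n + d))); rewrite linear0 linear_sum /=.
move=> E; rewrite -[RHS]E; apply: eq_bigr => i _.
by rewrite mxE (pihomogM _ _ (mderiv_homog i hF)) leq_addl addnK.
Qed.

End Syzygies.

Lemma zhomogP (k : fieldType) (m : nat) (f : {mpoly k[3]}) : zhomog m f <-> f \is m.-homog.
Proof.
split=> [h|h mon hm]; first by apply/dhomogP => mon /h [].
by rewrite -(dhomog_mf h hm).
Qed.

Lemma zhomog_pihomog (k : fieldType) (t : int) (m : nat) (f : {mpoly k[3]}) :
  zhomog t f -> pihomog mdeg m f != 0 -> t = m.
Proof.
move=> h nz; apply: contrapT => ne; case/eqP: nz; rewrite /pihomog big_seq_cond big1 // => mon.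
by case/andP => /h Et /eqP E; case: ne; rewrite -Et -E.
Qed.

(** * Saturation and generators of the Bourbaki ideal *)

Section Bourbaki.
Variables (k : closedFieldType) (d : nat) (F : {mpoly k[3]}).
Variables (e : nat) (eps : 'rV[{mpoly k[3]}]_3) (I : set {mpoly k[3]}).
Variable phi : 'rV[{mpoly k[3]}]_3 -> {mpoly k[3]}.
Hypotheses (hF : F \is d.+1.-homog) (min_eps : minimal_syzygy F e eps).
Hypothesis iso : graded_iso F eps I (e%:Z - d%:Z) phi.
Notation R := {mpoly k[3]}.

Let Seps : Syz F eps. Proof. by case: min_eps. Qed.
Let eps0 : eps != 0. Proof. by case: min_eps. Qed.

Lemma phi_lin (a : R) u v : Syz F u -> Syz F v -> phi (a *: u + v) = a * phi u + phi v.
Proof. by case: iso => h _ _ _; apply: h. Qed.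

Let phi0 : phi 0 = 0.
Proof.
have := phi_lin 1 (Syz0 F) (Syz0 F); rewrite scaler0 addr0 mul1r => /eqP.
by rewrite -subr_eq0 opprD addNKr oppr_eq0 => /eqP.
Qed.

Let phiZ (a : R) u : Syz F u -> phi (a *: u) = a * phi u.
Proof. by move=> Su; rewrite -[a *: u]addr0 (phi_lin _ Su (Syz0 F)) phi0 addr0. Qed.

Let phiD u v : Syz F u -> Syz F v -> phi (u + v) = phi u + phi v.
Proof. by move=> Su Sv; rewrite -[u]scale1r phi_lin // mul1r scale1r. Qed.

Let phi_sum n (c : 'I_n -> R) (g : 'I_n -> 'rV[R]_3) (P : pred 'I_n) :
  (forall i, Syz F (g i)) ->
  phi (\sum_(i | P i) c i *: g i) = \sum_(i | P i) c i * phi (g i).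
Proof.
move=> Sg; suff [] : Syz F (\sum_(i | P i) c i *: g i) /\
  phi (\sum_(i | P i) c i *: g i) = \sum_(i | P i) c i * phi (g i) by [].
apply: (big_rec2 (fun x y => Syz F x /\ phi x = y)) => [|i x y _ [Sx <-]].
  by split; [apply: Syz0 | apply: phi0].
split; first by apply: SyzD => //; apply: SyzZ.
by rewrite phi_lin.
Qed.

Let phi_img f : I f <-> exists2 v, Syz F v & phi v = f.
Proof. by case: iso => _ <- _ _. Qed.

Let phi_ker v : Syz F v -> phi v = 0 -> exists a, v = a *: eps.
Proof. by move=> Sv; case: iso => _ _ /(_ v Sv)[h _] _; apply: h. Qed.

Let phi_eps : phi eps = 0.
Proof. by case: iso => _ _ /(_ eps Seps)[_ h] _; apply: h; exists 1; rewrite scale1r. Qed.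

Let eps_free (c : R) : c *: eps = 0 -> c = 0.
Proof.
move=> E; apply: contrapT => /eqP c0; case/eqP: eps0; apply/rowP => j; rewrite mxE.
apply: (mulfI c0); rewrite mulr0.
by have := congr1 (fun v : 'rV[R]_3 => v 0 j) E; rewrite !mxE.
Qed.

(* The Koszul relation among the three lifts shows that the lift of x f can be
   taken divisible by x. *)
Lemma bourbaki_saturated f : (forall i, I ('X_i * f)) -> I f.
Proof.
move=> If; pose x : 'I_3 := ord0; pose y : 'I_3 := lift ord0 ord0; pose z : 'I_3 := ord_max.
have /phi_img[u Su Eu] := If x; have /phi_img[v Sv Ev] := If y.
have /phi_img[w Sw Ew] := If z.
have rel (c1 c2 : R) u1 u2 : Syz F u1 -> Syz F u2 -> c1 * phi u1 = c2 * phi u2 ->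
    exists a, c1 *: u1 - c2 *: u2 = a *: eps.
  move=> S1 S2 E; apply: phi_ker; first by apply: SyzD; [|apply: SyzN]; apply: SyzZ.
  by rewrite (phi_lin _ S1) ?E -?scaleNr ?phiZ // ?mulNr ?subrr //; apply: SyzZ.
have [|a Ea] := rel 'X_y 'X_x u v Su Sv; first by rewrite Eu Ev mulrCA.
have [|b Eb] := rel 'X_z 'X_x u w Su Sw; first by rewrite Eu Ew mulrCA.
have [|c Ec] := rel 'X_z 'X_y v w Sv Sw; first by rewrite Ev Ew mulrCA.
(* The Koszul relation among [u], [v], [w] passes to [a], [b], [c] because [eps] has no torsion. *)
have /eps_free K : ('X_z * a - 'X_y * b + 'X_x * c) *: eps = 0.
  by rewrite scalerDl scalerBl -!scalerA -Ea -Eb -Ec koszul_relation.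
have [//|//|//|p [q [r [Ep _]]]] := koszul_exact _ _ _ K.
(* Subtracting [p *: eps] from [u] does not change its image under [phi]; the prime ['X_x], dividing
   ['X_y] times the result, divides the result. *)
have Euv : 'X_y *: (u - p *: eps) = 'X_x *: (v + q *: eps).
  rewrite scalerBr scalerDr !scalerA -[_ *: u](subrK ('X_x *: v)) Ea Ep scalerDl.
  by rewrite addrAC [_ + _ - _]addrC addKr addrC.
have [w0 Ew0] : exists w0, u - p *: eps = 'X_x *: w0.
  have h j : exists t, (u - p *: eps) 0 j = t * 'X_x.
    have E := congr1 (fun s : 'rV[R]_3 => s 0 j) Euv; rewrite !mxE in E.
    have [|//|/ndiv_var] := linear_form_prime (p := (u - p *: eps) 0 j) (q := 'X_y)
      (var_neq0 k x) (homogXU k x).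
      by exists ((v + q *: eps) 0 j); rewrite !mxE mulrC E mulrC.
    by move/(_ isT).
  have [t Et] := choice h; exists (\row_j t j); apply/rowP => j.
  by rewrite Et !mxE mulrC.
have Sw0 : Syz F w0.
  apply: (Syz_cancel (var_neq0 k x)); rewrite -Ew0.
  by apply: SyzD => //; apply/SyzN/SyzZ.
apply/phi_img; exists w0 => //; apply: (mulfI (var_neq0 k x)); rewrite -Eu -phiZ // -Ew0.
by rewrite phiD -?scaleNr ?phiZ ?phi_eps ?mulr0 ?addr0 //; apply: SyzZ.
Qed.

Let phi_homog n v : Syz F v -> vec_homog n v -> zhomog (n%:Z + (e%:Z - d%:Z)) (phi v).
Proof. by case: iso => _ _ _ h; apply: h. Qed.

(** Since [phi] shifts degrees by [e - d], only one component of a preimage of [g] contributes in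
    degree [m]. *)
Lemma homog_preimage m g : g != 0 -> g \is m.-homog -> I g ->
  exists n v, [/\ Syz F v, vec_homog n v, phi v = g & (n + e = m + d)%N].
Proof.
move=> g0 hg /phi_img[v Sv Ev]; have [b Eb] := vec_part_sum v.
have Sp n : Syz F (vec_part n v) by apply: Syz_part hF _.
have Eg : g = \sum_(n < b) pihomog mdeg m (phi (vec_part n v)).
  rewrite -linear_sum -[LHS](pihomog_dE hg) -Ev {1}Eb; congr pihomog.
  have := phi_sum (fun _ : 'I_b => 1) predT (fun n => Sp n).
  by under eq_bigr do rewrite scale1r; move=> ->; apply: eq_bigr => n _; rewrite mul1r.
have [n nz] : exists n : 'I_b, pihomog mdeg m (phi (vec_part n v)) != 0.
  apply: contrapT => /forallNP z; case/eqP: g0; rewrite Eg big1 // => n _.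
  by apply/eqP/negPn/negP/z.
have degE n' : pihomog mdeg m (phi (vec_part n' v)) != 0 -> (n' + e = m + d)%N.
  move/(zhomog_pihomog (phi_homog (Sp n') (vec_part_homog n' v))) => /eqP.
  by rewrite addrA subr_eq -!PoszD eqz_nat => /eqP.
exists n, (vec_part n v); split; [exact: Sp | exact: vec_part_homog | | exact: degE].
rewrite [RHS]Eg (bigD1 n) //= big1 ?addr0 => [|n' ne].
  rewrite pihomog_dE //; apply/zhomogP; have := phi_homog (Sp n) (vec_part_homog n v).
  by rewrite addrA -PoszD (degE _ nz) PoszD addrK.
apply: contrapT => /eqP /degE; rewrite -(degE _ nz) => /addIn /val_inj En.
by rewrite En eqxx in ne.
Qed.

(** Descending induction on the degree: by saturation [f] is in [I] as soon as its products with the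
    variables are. *)
Lemma contains_vanishing : contains_high_vanishing I ->
  forall n f, f \is n.-homog -> vanishes (zero_locus I) f -> I f.
Proof.
move=> [M hM] n f hf fV; have [j] : exists j, (M <= n + j)%N by exists M; apply: leq_addl.
elim: j n f hf fV => [|j IH] n f hf fV le; first by apply: (hM n) => //; rewrite addn0 in le.
apply: bourbaki_saturated => i; apply: (IH n.+1).
- by apply: (homogM_eq (homogXU _ i) hf).
- by move=> P PI; rewrite mevalM fV // mulr0.
- by rewrite addSnnS.
Qed.

Hypotheses (idI : ideal I) (grI : graded I).

Lemma homog0_const n (f : {mpoly k[n]}) : f \is 0.-homog -> f = (f@_0)%:MP.
Proof.
move=> hf; apply/mpolyP => m; rewrite mcoeffC; case: (eqVneq m 0%MM) => [->|m0].
  by rewrite mulr1.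
by rewrite mulr0 (dhomog_nemf_coeff hf) //= mdeg_eq0.
Qed.

(** The lines through [P] generate [I], and their lifts together with [eps] generate the syzygies.
    Minimality comes from the independence of the lines and the minimal degree of [eps]. *)
Lemma nearly_free_of_point P : zero_locus I = [set P] -> contains_high_vanishing I ->
  nearly_free d F.
Proof.
move=> VP /contains_vanishing sub; have [Pi _] := chartP P; set i := chart P in Pi.
pose l (a : 'I_2) : R := 'X_(lift i a) - coords P (lift i a) *: 'X_i.
(* Points dual to the two lines: evaluation there reads off constant coefficients. *)
pose pt (a : 'I_2) (j : 'I_3) : k := (j == lift i a)%:R.
have lpt a b : (l a).@[pt b] = (a == b)%:R.
  by rewrite mevalB mevalZ !mevalXU /pt (inj_eq lift_inj) (negbTE (neq_lift _ _)) mulr0 subr0.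
have l0 a : l a != 0.
  by apply/eqP => E; have := lpt a a; rewrite E meval0 eqxx => /esym/eqP; rewrite oner_eq0.
have hl a : l a \is 1.-homog by apply: rpredB; [|apply: rpredZ]; apply: homogXU.
have Il a : I (l a).
  apply: sub (hl a) _; rewrite VP => _ ->.
  by rewrite mevalB mevalZ !mevalXU Pi mulr1 subrr.
have Ispan f : I f -> exists c : 'I_2 -> R, f = \sum_a c a * l a.
  pose K := [set f | exists c : 'I_2 -> R, f = \sum_a c a * l a].
  have idK : ideal K.
    split=> [|g h [c ->] [c' ->]|g h [c ->]].
    - by exists (fun=> 0); rewrite big1 // => a _; rewrite mul0r.
    - by exists (fun a => c a + c' a); rewrite -big_split; apply: eq_bigr => a _; rewrite mulrDl.
    - by exists (fun a => g * c a); rewrite mulr_sumr; apply: eq_bigr => a _; rewrite mulrA.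
  move=> If; rewrite (pihomog_partitionE (leqnn (msize f))); apply: (ideal_sum idK) => m _.
  apply: (form_in_ideal_of_point (p := coords P) (i := i) idK _ _ (pihomogP mdeg m f)).
  - by rewrite Pi oner_neq0.
  - move=> j; rewrite Pi scale1r; have [a ->|->] := unliftP i j; last first.
      by rewrite Pi scale1r subrr; apply: ideal0.
    exists (fun b => (b == a)%:R); rewrite (bigD1 a) //= eqxx mul1r big1 ?addr0 // => b /negbTE ->.
    by rewrite mul0r.
  - have PI : zero_locus I P by rewrite VP.
    by apply: PI; apply: grI.
have [n0 En0] : exists n0, (n0 + e = 1 + d)%N.
  by have [n [v [_ _ _ E]]] := homog_preimage (l0 ord0) (hl ord0) (Il ord0); exists n.
have ex_v a : exists v, [/\ Syz F v, vec_homog n0 v & phi v = l a].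
  have [n [v [Sv hv Ev E]]] := homog_preimage (l0 a) (hl a) (Il a).
  by exists v; split=> //; suff -> : n0 = n by []; apply: (@addIn e); rewrite En0 E.
have [v hv] := choice ex_v.
pose g (j : 'I_3) := oapp v eps (unlift ord0 j).
have Sg j : Syz F (g j) by rewrite /g; case: (unlift ord0 j) => [a|] //=; case: (hv a).
have sum_g (c : 'I_3 -> R) :
    \sum_j c j *: g j = c ord0 *: eps + \sum_a c (lift ord0 a) *: v a.
  by rewrite big_ord_recl /g unlift_none /=; congr (_ + _); apply: eq_bigr => a _; rewrite liftK.
have Sv a : Syz F (v a) by case: (hv a).
have Ssum (c : 'I_2 -> R) : Syz F (\sum_a c a *: v a) by apply: Syz_sum.
have phi_sv (c : 'I_2 -> R) : phi (\sum_a c a *: v a) = \sum_a c a * l a.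
  by rewrite phi_sum //; apply: eq_bigr => a _; case: (hv a) => _ _ ->.
have [_ _ heps emin] := min_eps.
have len : (e <= n0)%N.
  apply: (emin n0 (v ord0)) => //; last by case: (hv ord0).
  apply: contra_neq (l0 ord0) => v0; case: (hv ord0) => _ _ <-.
  by rewrite v0 phi0.
exists e, n0, n0, g; split=> //; last by rewrite addnC En0.
  move=> j; rewrite /g; have [a ->|->] := unliftP ord0 j; last by [].
  rewrite /=; have -> : nth 0%N [:: n0; n0] a = n0 by case: a => [[|[|]]].
  by case: (hv a).
split.
  apply/seteqP; split=> [_ [c ->]|w Sw]; first exact: Syz_sum.
  have [c Ec] : exists c : 'I_2 -> R, phi w = \sum_a c a * l a.
    by apply: Ispan; apply/phi_img; exists w.
  have [||c0 Ec0] := @phi_ker (w - \sum_a c a *: v a).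
  - by apply: SyzD => //; apply: SyzN.
  - by rewrite -scaleN1r addrC phi_lin // phi_sv Ec mulN1r addNr.
  exists (fun j => oapp c c0 (unlift ord0 j)); rewrite (eq_bigl predT) => [|j]; last by rewrite inE.
  rewrite sum_g unlift_none /= -Ec0; under eq_bigr do rewrite liftK /=.
  by rewrite subrK.
move=> J /properP[_ [j _ jJ]] EJ.
have [c cj Ec] : exists2 c : 'I_3 -> R, c j = 0 & g j = \sum_j c j *: g j.
  have [c Ec] : spans g J (g j) by rewrite EJ.
  exists (fun i => if i \in J then c i else 0); first by rewrite (negbTE jJ).
  rewrite Ec big_mkcond; apply: eq_bigr => j' _.
  by case: ifP => _; rewrite ?scale0r.
(* If [g j] is a lift, applying [phi] and evaluating at the dual point gives [1 = 0]. *)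
move: Ec; rewrite sum_g; have [a Ej|Ej] := unliftP ord0 j.
  move/(congr1 phi); rewrite /g Ej liftK /= phi_lin // phi_eps mulr0 add0r phi_sv.
  case: (hv a) => _ _ -> /(congr1 (meval (pt a))).
  rewrite lpt eqxx linear_sum big1 /= => [/eqP|b _]; first by rewrite oner_eq0.
  rewrite mevalM lpt; case: eqVneq => [->|_]; last by rewrite mulr0.
  by rewrite -Ej cj meval0 mul0r.
(* If [g j] is [eps], only coefficients of degree [e - n0] matter. As [e <= n0], they are 0 or
   constants, and [phi] with the dual points shows that the constants vanish. *)
have c0 : c ord0 = 0 by rewrite -Ej.
rewrite /g Ej unlift_none /= c0 scale0r add0r => Eeps.
have {}Eeps : eps = \sum_a (if (n0 <= e)%N then pihomog mdeg (e - n0) (c (lift ord0 a)) else 0) *: v a.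
  rewrite -[LHS](vec_part_id heps) {1}Eeps vec_part_sumr; apply: eq_bigr => a _.
  have hva : vec_homog n0 (v a) by case: (hv a).
  by rewrite (vec_partZ _ _ hva); case: ifP; rewrite ?scale0r.
case: leqP Eeps => [le|_] Eeps; last first.
  by case/eqP: eps0; rewrite Eeps big1 // => a _; rewrite scale0r.
have {le}en : (e - n0 = 0)%N by apply/eqP; rewrite subn_eq0.
case/eqP: eps0; rewrite Eeps big1 // => a _; rewrite en in Eeps *.
have := congr1 (meval (pt a)) (congr1 phi Eeps); rewrite phi_eps phi_sv meval0 linear_sum /=.
rewrite (bigD1 a) //= big1 ?addr0 => [|b ne]; last by rewrite mevalM lpt (negbTE ne) mulr0.
rewrite mevalM lpt eqxx mulr1 [X in X.@[_]]homog0_const ?pihomogP // mevalC => E.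
by rewrite [pihomog _ _ _]homog0_const ?pihomogP // -E mpolyC0 scale0r.
Qed.

(** Some generator [g j] occurs in [eps] with a nonzero constant coefficient, so its image under
    [phi] is redundant; the other two generators map to linear forms. *)
Lemma point_of_nearly_free :
  (forall h : R, (forall f, I f -> exists q, f = q * h) -> (msize h <= 1)%N) ->
  nearly_free d F -> exists P, zero_locus I = [set P] /\
    forall n f, f \is n.-homog -> f.@[coords P] = 0 -> I f.
Proof.
move=> ncf [d1 [d2 [d3 [g [hg [genS minS] le12 e23 e12]]]]].
subst d3; set dd := fun i : 'I_3 => nth 0%N [:: d1; d2; d2] i in hg.
have spanE w : Syz F w <-> exists c : 'I_3 -> R, w = \sum_i c i *: g i.
  rewrite -genS; split=> -[c ->]; exists c; apply: eq_bigl => i; by rewrite inE.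
have Sg i : Syz F (g i).
  apply/spanE; exists (fun j => (j == i)%:R); rewrite (bigD1 i) //= eqxx scale1r.
  by rewrite big1 ?addr0 // => j /negbTE ->; rewrite scale0r.
have [_ _ heps emin] := min_eps.
(* A zero generator could be omitted, against minimality. *)
have g0 : g ord0 != 0.
  apply/eqP => g0; apply: (minS (~: [set ord0])%SET).
    by apply/properP; split; [apply/fintype.subsetP => i; rewrite inE | exists ord0; rewrite !inE ?eqxx].
  apply/seteqP; split=> [_ [c ->]|w /spanE[c ->]]; first exact: Syz_sum.
  exists c; rewrite (bigD1 ord0) //= g0 scaler0 add0r; apply: eq_bigl => i.
  by rewrite !inE.
have [c Ec] : exists c : 'I_3 -> R, eps = \sum_i c i *: g i by apply/spanE.
(* By homogeneity of [eps], only the component of degree [e - dd i] of each coefficient is kept. *)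
pose c' i := if (dd i <= e)%N then pihomog mdeg (e - dd i) (c i) else 0.
have Ec' : eps = \sum_i c' i *: g i.
  rewrite -[LHS](vec_part_id heps) {1}Ec vec_part_sumr; apply: eq_bigr => i _.
  by rewrite (vec_partZ _ _ (hg i)) /c'; case: ifP; rewrite ?scale0r.
have [j nz] : exists j, c' j *: g j != 0.
  apply: contrapT => /forallNP z; case/eqP: eps0; rewrite Ec' big1 // => i _.
  by apply/eqP/negPn/negP/z.
have gj0 : g j != 0 by apply: contra_neq nz => ->; rewrite scaler0.
have c'j0 : c' j != 0 by apply: contra_neq nz => ->; rewrite scale0r.
have lej : (dd j <= e)%N by move: c'j0; rewrite /c'; case: ifP; rewrite ?eqxx.
have ej : e = dd j by apply/eqP; rewrite eqn_leq lej (emin _ _ (Sg j) gj0 (hg j)).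
have le1 : (e <= d1)%N by apply: emin (Sg ord0) g0 (hg ord0).
have ddge i : (d1 <= dd i)%N by rewrite /dd; move: i; apply: ord3_ind.
have ed1 : e = d1 by apply/eqP; rewrite eqn_leq le1 ej ddge.
(* The two remaining generators have degree [d2] in every case: if [j] is not the first index, then
   [e = d1] forces [d1 = d2]. *)
have ddE i : i != j -> dd i = d2.
  move=> ij; have [j0|j0] := eqVneq j ord0.
    by move: ij; rewrite j0 /dd; move: i; apply: ord3_ind.
  have E12 : d1 = d2.
    by move: j0 ej; rewrite ed1 /dd; move: (j); apply: ord3_ind.
  by rewrite /dd -E12; move: i {ij}; apply: ord3_ind.
pose L (a : 'I_2) := phi (g (lift j a)).
have hL a : L a \is 1.-homog.
  apply/zhomogP; have := phi_homog (Sg (lift j a)) (hg (lift j a)).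
  rewrite -/(dd _) ddE 1?eq_sym ?neq_lift // addrA -PoszD ed1 [(d2 + _)%N]addnC e12.
  by rewrite -addn1 PoszD addrAC subrr add0r.
have Sum_j (b : 'I_3 -> R) : phi (\sum_i b i *: g i) =
    b j * phi (g j) + (b (lift j ord0) * L ord0 + b (lift j ord_max) * L ord_max).
  rewrite phi_sum // (bigD1_ord j) //= !big_ord_recl big_ord0 addr0; congr (_ + (_ + _)).
  by rewrite (_ : lift ord0 ord0 = ord_max :> 'I_2) //; apply: val_inj.
pose K := [set f : R | exists a b, f = a * L ord0 + b * L ord_max].
have idK : ideal K.
  split=> [|f f' [a [b ->]] [a' [b' ->]]|r f [a [b ->]]].
  - by exists 0, 0; rewrite !mul0r addr0.
  - by exists (a + a'), (b + b'); rewrite !mulrDl addrACA.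
  - by exists (r * a), (r * b); rewrite mulrDr !mulrA.
have KL a b : K (a * L ord0 + b * L ord_max) by exists a, b.
(* The relation [phi eps = 0], divided by the constant coefficient of [g j], expresses [phi (g j)]
   by the two linear forms. *)
have Kj : K (phi (g j)).
  have hc' : c' j \is 0.-homog by rewrite /c' lej ej subnn pihomogP.
  have Cj := homog0_const hc'; set t := (c' j)@_0 in Cj.
  have t0 : t != 0 by apply: contra_neq c'j0 => t0; rewrite Cj t0 mpolyC0.
  have := phi_eps; rewrite Ec' Sum_j => /eqP; rewrite addr_eq0 => /eqP E.
  have -> : phi (g j) = (t^-1)%:MP * (c' j * phi (g j)).
    by rewrite Cj mulrA -mpolyCM mulVf // mul1r.
  by rewrite E; apply: (idealM idK); apply: (idealN idK).
apply: (two_lines_point (hL ord0) (hL ord_max) _ ncf) => f; split=> [/phi_img[w Sw <-]|].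
  have /spanE[b ->] := Sw; rewrite Sum_j; apply: (idealD idK) => //.
  exact: (idealM idK).
case=> a [b ->]; apply: (idealD idI); apply: (idealM idI); apply/phi_img.
  by exists (g (lift j ord0)).
by exists (g (lift j ord_max)).
Qed.

End Bourbaki.

(** * Bourbaki degree, number of zeros and nearly free curves *)

Theorem corollary3p7 (k : closedFieldType) (d : nat) (F : {mpoly k[3]})
    (homogF : F \is (d.+1).-homog) (reducedF : reduced_form F)
    (char_ndvd : forall p : nat, p \in [pchar k] -> ~~ (p %| d.+1)%N)
    (e : nat) (eps : 'rV[{mpoly k[3]}]_3) (min_eps : minimal_syzygy F e eps)
    (I : set {mpoly k[3]}) (bourI : bourbaki_ideal d F e eps I) :
  exists ell : nat,
    [/\ (zero_locus I #= `I_ell)%card,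
        (ell <= bour I)%N,
        bour I = ell <-> (forall P, zero_locus I P -> local_bour I P = 1%N) &
        nearly_free d F <->
          exists P0, zero_locus I = [set P0] /\ local_bour I P0 = 1%N].
Proof.
have [[gs [-> hgs ncf]] [phi iso]] := bourI.
have [r [Q [injQ rQ le_r bour_r red_local]]] := bour_reduced hgs ncf.
exists r; split=> //.
- by rewrite -rQ; apply: card_range_ord.
- by rewrite bour_r.
split=> [nf|[P [VP P1]]].
  have [|P [VP sub]] := point_of_nearly_free min_eps iso (ideal_gen_ideal gs) _ nf.
    by move=> h hdiv; apply: ncf => g gin; apply/hdiv/mem_ideal_gen.
  exists P; split=> //; have [local _] := red_local.
  apply: local; last by rewrite VP.
  by exists 0%N => n f _ hf; rewrite VP => fV; apply: sub hf _; apply: fV.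
apply: (nearly_free_of_point homogF min_eps iso (ideal_gen_graded hgs) VP).
by apply/red_local => P'; rewrite VP => ->.
Qed.
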